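(* Let $r,s\in\mathbb{N}$ with $r,s\geq 2$ and $\log_r(s)\notin\mathbb{Q}$. Then the structure $(\mathbb{R},<,+,W_r,W_s)$ defines (with parameters) every compact set, i.e. every compact subset of $\mathbb{R}^n$ for every $n$.
   Context: Let $\Sigma_r=\{0,\ldots,r-1\}$. A base $r$ expansion of $x\in\mathbb{R}$ is a word $a_p\cdots a_0\star a_{-1}a_{-2}\cdots$ with $a_p\in\{0,r-1\}$, $a_{p-1},a_{p-2},\ldots\in\Sigma_r$, such that $x=-a_pr^p+\sum_{i=-\infty}^{p-1}a_ir^i$. $V_r(x,u,k)$ holds iff some base $r$ expansion of $x$ has $u=r^n$ for some $n\in\mathbb{Z}$ and $a_n=k$. $W_r$ is the intersection of $V_r$ with $[0,1]\times r^{-\mathbb{N}}\times\Sigma_r$, where $\mathbb{N}$ contains $0$. $W_s$ is defined analogously with $s$ in place of $r$. *)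

(* Defs.v *)
From mathcomp Require Import all_boot all_order all_algebra.
From mathcomp Require Import all_classical all_reals all_analysis.

Set Implicit Arguments.
Unset Strict Implicit.
Unset Printing Implicit Defensive.

Import Order.TTheory GRing.Theory Num.Theory.
Import numFieldNormedType.Exports.

Local Open Scope classical_set_scope.
Local Open Scope ring_scope.

(* First-order formulas over the language {<, +, W1, W2} with W1 and W2
   ternary relation symbols; variables are de Bruijn indices. *)
Inductive term : Type :=
| TVar of nat
| TAdd of term & term.

Inductive formula : Type :=
| FEq of term & term
| FLt of term & term
| FW1 of term & term & term
| FW2 of term & term & term
| FNot of formula
| FAnd of formula & formula
| FOr of formula & formula
| FImplies of formula & formula
| FExists of formula
| FForall of formula.

Section Semantics.
Variable R : realType.

(* As in GRing.eval, a valuation is a finite sequence, and a variable beyond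
   its end takes the value 0. *)
Fixpoint eval (e : seq R) (t : term) : R :=
  match t with
  | TVar i => e`_i
  | TAdd t1 t2 => eval e t1 + eval e t2
  end.

(* Satisfaction in the structure (R, <, +, A, B). *)
Fixpoint sat (A B : set (R * R * R)) (e : seq R) (f : formula) : Prop :=
  match f with
  | FEq t1 t2 => eval e t1 = eval e t2
  | FLt t1 t2 => eval e t1 < eval e t2
  | FW1 t1 t2 t3 => A (eval e t1, eval e t2, eval e t3)
  | FW2 t1 t2 t3 => B (eval e t1, eval e t2, eval e t3)
  | FNot f1 => ~ sat A B e f1
  | FAnd f1 f2 => sat A B e f1 /\ sat A B e f2
  | FOr f1 f2 => sat A B e f1 \/ sat A B e f2
  | FImplies f1 f2 => sat A B e f1 -> sat A B e f2
  | FExists f1 => exists x : R, sat A B (x :: e) f1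
  | FForall f1 => forall x : R, sat A B (x :: e) f1
  end.

(* X = {v in R^n | (R, <, +, A, B) |= f(v, b)} for a formula f and a finite
   tuple b of real parameters. *)
Definition definable (A B : set (R * R * R)) (n : nat) (X : set 'rV[R]_n) :
    Prop :=
  exists (f : formula) (b : seq R),
    X = [set v | sat A B ([seq v ord0 i | i <- enum 'I_n] ++ b) f].

(* The word a_p ... a_0 * a_{-1} a_{-2} ... is a base r expansion of x.
   The values of a at indices above p are irrelevant. *)
Definition is_expansion (r p : nat) (a : int -> nat) (x : R) : Prop :=
  [/\ a p = 0%N \/ a p = r.-1,
      forall i : int, i < p%:Z -> (a i < r)%N &
      - ((a p)%:R * r%:R ^ p%:Z) +
        \sum_(0 <= j < N)
          (a (p%:Z - 1 - j%:Z))%:R * r%:R ^ (p%:Z - 1 - j%:Z)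
        @[N --> \oo] --> x].

Definition V (r : nat) : set (R * R * R) :=
  [set xuk | exists (p : nat) (a : int -> nat) (n : int),
    [/\ is_expansion r p a xuk.1.1, n <= p%:Z,
        xuk.1.2 = r%:R ^ n & xuk.2 = (a n)%:R]].

Definition W (r : nat) : set (R * R * R) :=
  V r `&` (`[0, 1] `*` [set r%:R ^- m | m in [set: nat]]
                   `*` [set d%:R | d in `I_r]).

Definition log (r s : nat) : R := ln s%:R / ln r%:R.

End Semantics.

Arguments W {R} r.
Arguments V {R} r.

(* Main.v *)
Require Import Defs.
From mathcomp Require Import all_boot all_order all_algebra.
From mathcomp Require Import all_classical all_reals all_analysis.
From mathcomp Require Import ring lra zify.

(**
Reals in [0,1] code sets of powers of r (or of s) through their digits, and
"x is a multiple of r^-m" is definable because x then has two different digits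
at r^-m.  It suffices to define a partial function rho from powers of r or s to
powers of s, all of whose fibres are infinite: choosing labels
c_0 > c_1 > ... with rho(c_2t), rho(c_2t+1) running through the pairs of an
arbitrary relation T on the powers of s, the sets of even and of odd labels are
two parameters that define T.  Digits are then arbitrary in two indices, so every
sequence of irrationals of (0,1), indexed by powers of s, is definable, and a
compact set is the complement of a sequence of boxes.

If a prime p divides s but not r, the differences of powers of s are never
multiples of r^-m; one builds a real y which is, for sparse m_j, extremely close
to s^-h(j) modulo r^-m_j, and rho(r^-m_j) := s^-h(j) can be read off from y.

Otherwise choose L, G with s^L dividing r^G such that the last nonzero base r
digit of s^-Ln is exactly at r^-Gn.  The powers of S = s^L and Q = r^G satisfy
2S <= Q because log_r s is irrational, and S^-n |-> (largest power of S below
Q^-n) is a definable map whose exponent function f stretches distances.  Orbits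
of f started outside its image are disjoint and definable (an orbit is a set,
coded by a real), and rho maps each orbit to the power of s that indexes it.
*)

Set Implicit Arguments.
Unset Strict Implicit.
Unset Printing Implicit Defensive.

Import Order.TTheory GRing.Theory Num.Theory.
Import numFieldNormedType.Exports.
Local Open Scope classical_set_scope.
Local Open Scope ring_scope.

(** * Definable predicates *)

Section Definability.
Variable R : realType.
Variables A B : set (R * R * R).
Implicit Types (v : nat -> R) (P Q : (nat -> R) -> Prop).

(** Valuations are total functions here, so that renaming variables is composition; [fsat_nth] leads
    back to finite sequences. *)
Definition scons (x : R) v (i : nat) : R := if i is j.+1 then v j else x.

Fixpoint teval v (t : term) : R :=
  match t with
  | TVar i => v i
  | TAdd t1 t2 => teval v t1 + teval v t2
  end.

Fixpoint fsat v (f : formula) : Prop :=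
  match f with
  | FEq t1 t2 => teval v t1 = teval v t2
  | FLt t1 t2 => teval v t1 < teval v t2
  | FW1 t1 t2 t3 => A (teval v t1, teval v t2, teval v t3)
  | FW2 t1 t2 t3 => B (teval v t1, teval v t2, teval v t3)
  | FNot f1 => ~ fsat v f1
  | FAnd f1 f2 => fsat v f1 /\ fsat v f2
  | FOr f1 f2 => fsat v f1 \/ fsat v f2
  | FImplies f1 f2 => fsat v f1 -> fsat v f2
  | FExists f1 => exists x : R, fsat (scons x v) f1
  | FForall f1 => forall x : R, fsat (scons x v) f1
  end.

Lemma teval_nth e t : teval (nth 0 e) t = Defs.eval e t.
Proof. by elim: t => //= t1 -> t2 ->. Qed.

Lemma scons_nth x e : scons x (nth 0 e) = nth 0 (x :: e).
Proof. by apply/funext => -[]. Qed.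

Lemma fsat_nth e f : fsat (nth 0 e) f <-> sat A B e f.
Proof.
elim: f e => /= [t1 t2|t1 t2|t1 t2 t3|t1 t2 t3|f IHf|f IHf g IHg|f IHf g IHg
  |f IHf g IHg|f IHf|f IHf] e; rewrite ?teval_nth ?IHf ?IHg //.
- by split=> -[x hx]; exists x; move: hx; rewrite scons_nth IHf.
- by split=> h x; move: (h x); rewrite scons_nth IHf.
Qed.

Fixpoint tren (rho : nat -> nat) (t : term) : term :=
  match t with
  | TVar i => TVar (rho i)
  | TAdd t1 t2 => TAdd (tren rho t1) (tren rho t2)
  end.

Definition up (rho : nat -> nat) (i : nat) : nat :=
  if i is j.+1 then (rho j).+1 else 0%N.

Fixpoint ren (rho : nat -> nat) (f : formula) : formula :=
  match f with
  | FEq t1 t2 => FEq (tren rho t1) (tren rho t2)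
  | FLt t1 t2 => FLt (tren rho t1) (tren rho t2)
  | FW1 t1 t2 t3 => FW1 (tren rho t1) (tren rho t2) (tren rho t3)
  | FW2 t1 t2 t3 => FW2 (tren rho t1) (tren rho t2) (tren rho t3)
  | FNot f1 => FNot (ren rho f1)
  | FAnd f1 f2 => FAnd (ren rho f1) (ren rho f2)
  | FOr f1 f2 => FOr (ren rho f1) (ren rho f2)
  | FImplies f1 f2 => FImplies (ren rho f1) (ren rho f2)
  | FExists f1 => FExists (ren (up rho) f1)
  | FForall f1 => FForall (ren (up rho) f1)
  end.

Lemma teval_tren v rho t : teval v (tren rho t) = teval (v \o rho) t.
Proof. by elim: t => //= t1 -> t2 ->. Qed.

Lemma scons_up x v rho : scons x v \o up rho = scons x (v \o rho).
Proof. by apply/funext => -[]. Qed.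

Lemma fsat_ren v rho f : fsat v (ren rho f) <-> fsat (v \o rho) f.
Proof.
elim: f v rho => /= [t1 t2|t1 t2|t1 t2 t3|t1 t2 t3|f IHf|f IHf g IHg
  |f IHf g IHg|f IHf g IHg|f IHf|f IHf] v rho;
  rewrite ?teval_tren ?IHf ?IHg //.
- by split=> -[x hx]; exists x; move: hx; rewrite IHf scons_up.
- by split=> h x; move: (h x); rewrite IHf scons_up.
Qed.

(* The parameters [b] occupy the first variables. *)
Definition pre (b : seq R) v (i : nat) : R :=
  if (i < size b)%N then b`_i else v (i - size b)%N.

(** Stated for predicates on valuations, so that definability can be proved along the shape of the
    predicate, without writing out formulas. *)
Definition dfn P : Prop :=
  exists (f : formula) (b : seq R), forall v, P v <-> fsat (pre b v) f.

Definition dterm (t : (nat -> R) -> R) : Prop :=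
  exists (u : term) (b : seq R), forall v, t v = teval (pre b v) u.

Lemma pre_catl b1 b2 v :
  pre (b1 ++ b2) v \o (fun i => if (i < size b1)%N then i else (i + size b2)%N)
  = pre b1 v.
Proof.
apply/funext => i; rewrite /pre /= size_cat nth_cat; case: (ltnP i (size b1)) => h.
  by rewrite h ltn_addr.
by rewrite ltn_add2r ltnNge h /= subnDr.
Qed.

Lemma pre_catr b1 b2 v :
  pre (b1 ++ b2) v \o (fun i => (size b1 + i)%N) = pre b2 v.
Proof.
apply/funext => i; rewrite /pre /= size_cat nth_cat ltn_add2l subnDl.
by case: ifP => // h; rewrite ltnNge leq_addr /= addKn.
Qed.

(** A quantifier binds variable 0, while [pre] reserves the first places for parameters; the
    renaming reconciles the two orders. *)
Lemma pre_scons b x v :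
  scons x (pre b v) \o (fun i => if (i < size b)%N then i.+1
     else if i == size b then 0%N else i)
  = pre b (scons x v).
Proof.
apply/funext => i; rewrite /pre /=; case: (ltngtP i (size b)) => [h|h|->] //=.
- by rewrite h.
- by case: i h => // i h; rewrite subSn //= ltnNge -ltnS h.
- by rewrite subnn.
Qed.

Lemma dfn_iff P Q : (forall v, P v <-> Q v) -> dfn P -> dfn Q.
Proof. by move=> h [f [b hf]]; exists f, b => v; rewrite -h. Qed.

Lemma dfn_conn (op : Prop -> Prop -> Prop) (fop : formula -> formula -> formula)
  P Q : (forall v f g, fsat v (fop f g) = op (fsat v f) (fsat v g)) ->
  dfn P -> dfn Q -> dfn (fun v => op (P v) (Q v)).
Proof.
move=> hop [f [b hf]] [g [c hg]].
exists (fop (ren (fun i => if (i < size b)%N then i else (i + size c)%N) f)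
            (ren (fun i => size b + i)%N g)), (b ++ c) => v; rewrite hop.
by move: (hf v) (hg v); rewrite -(pre_catl b c) -(pre_catr b c) -!fsat_ren
  => /propext -> /propext ->.
Qed.

Lemma dfn_and P Q : dfn P -> dfn Q -> dfn (fun v => P v /\ Q v).
Proof. exact: (@dfn_conn _ FAnd). Qed.

Lemma dfn_or P Q : dfn P -> dfn Q -> dfn (fun v => P v \/ Q v).
Proof. exact: (@dfn_conn _ FOr). Qed.

Lemma dfn_imp P Q : dfn P -> dfn Q -> dfn (fun v => P v -> Q v).
Proof. exact: (@dfn_conn (fun p q => p -> q) FImplies). Qed.

Lemma dfn_not P : dfn P -> dfn (fun v => ~ P v).
Proof. by move=> [f [b hf]]; exists (FNot f), b => v /=; rewrite hf. Qed.

Lemma dfn_ex (P : (nat -> R) -> R -> Prop) :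
  dfn (fun v => P (fun i => v i.+1) (v 0%N)) -> dfn (fun v => exists x, P v x).
Proof.
move=> [f [b hf]]; exists (FExists (ren (fun i => if (i < size b)%N then i.+1
     else if i == size b then 0%N else i) f)), b => v /=.
by split=> -[x hx]; exists x; move: (hf (scons x v)) hx;
  rewrite fsat_ren pre_scons => /= <-.
Qed.

Lemma dfn_all (P : (nat -> R) -> R -> Prop) :
  dfn (fun v => P (fun i => v i.+1) (v 0%N)) -> dfn (fun v => forall x, P v x).
Proof.
move=> /dfn_not h.
apply: dfn_iff (dfn_not (@dfn_ex (fun v x => ~ P v x) h)) => v; split.
  by move=> hP x; apply: contrapT => hx; apply: hP; exists x.
by move=> hP [x]; apply.
Qed.

Lemma dterm_var i : dterm (fun v => v i).
Proof. by exists (TVar i), [::] => v /=; rewrite /pre /= subn0. Qed.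

Lemma dterm_cst (c : R) : dterm (fun=> c).
Proof. by exists (TVar 0), [:: c]. Qed.

Lemma dterm_add t1 t2 : dterm t1 -> dterm t2 -> dterm (fun v => t1 v + t2 v).
Proof.
move=> [u1 [b1 h1]] [u2 [b2 h2]].
exists (TAdd (tren (fun i => if (i < size b1)%N then i else (i + size b2)%N) u1)
            (tren (fun i => size b1 + i)%N u2)), (b1 ++ b2) => v /=.
by rewrite h1 h2 -(pre_catl b1 b2) -(pre_catr b1 b2) !teval_tren.
Qed.

Lemma dterm_muln t n : dterm t -> dterm (fun v => t v *+ n).
Proof.
move=> ht; elim: n => [|n IHn]; first exact: dterm_cst.
have := dterm_add ht IHn; congr dterm; apply/funext => v; exact/esym/mulrS.
Qed.

Lemma dterm_shift t : dterm t -> dterm (fun v => t (fun i => v i.+1)).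
Proof.
move=> [u [b h]]; exists (tren (fun i => if (i < size b)%N then i else i.+1) u), b.
move=> v; rewrite h teval_tren; congr teval; apply/funext => i.
rewrite /pre /=; case: (ltnP i (size b)) => hi; first by rewrite hi.
by rewrite ltnNge leqW //= subSn.
Qed.

Lemma dfn_eq t1 t2 : dterm t1 -> dterm t2 -> dfn (fun v => t1 v = t2 v).
Proof.
move=> [u1 [b1 h1]] [u2 [b2 h2]].
exists (FEq (tren (fun i => if (i < size b1)%N then i else (i + size b2)%N) u1)
            (tren (fun i => size b1 + i)%N u2)), (b1 ++ b2) => v /=.
by rewrite h1 h2 !teval_tren pre_catl pre_catr.
Qed.

Lemma dfn_lt t1 t2 : dterm t1 -> dterm t2 -> dfn (fun v => t1 v < t2 v).
Proof.
move=> [u1 [b1 h1]] [u2 [b2 h2]].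
exists (FLt (tren (fun i => if (i < size b1)%N then i else (i + size b2)%N) u1)
            (tren (fun i => size b1 + i)%N u2)), (b1 ++ b2) => v /=.
by rewrite h1 h2 !teval_tren pre_catl pre_catr.
Qed.

Lemma dfn_le t1 t2 : dterm t1 -> dterm t2 -> dfn (fun v => t1 v <= t2 v).
Proof.
move=> h1 h2; apply: dfn_iff (dfn_not (dfn_lt h2 h1)) => v.
by rewrite leNgt; split=> /negP.
Qed.

Lemma dfn_ren P (rho : nat -> nat) : dfn P -> dfn (fun v => P (v \o rho)).
Proof.
move=> [f [b hf]]; exists (ren (fun i => if (i < size b)%N then i
  else (size b + rho (i - size b))%N) f), b => v.
rewrite hf fsat_ren; suff -> : pre b (v \o rho) = pre b v \o
  (fun i => if (i < size b)%N then i else (size b + rho (i - size b))%N) by [].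
apply/funext => i; rewrite /pre /=; case: (ltnP i (size b)) => hi; first by rewrite hi.
by rewrite ltnNge leq_addr /= addKn.
Qed.

(** A fresh existential variable equal to the term takes the place of substitution in formulas. *)
Lemma dfn_subst1 (Q : R -> Prop) t1 : dfn (fun v => Q (v 0%N)) -> dterm t1 ->
  dfn (fun v => Q (t1 v)).
Proof.
move=> hQ h1.
apply: (@dfn_iff (fun v => exists x, x = t1 v /\ Q x)).
  by move=> v; split=> [[x [->]]//|h]; exists (t1 v).
apply: dfn_ex; apply: dfn_and; last exact: hQ.
by apply: dfn_eq; [exact: dterm_var | exact: dterm_shift].
Qed.

Lemma dfn_subst2 (Q : R -> R -> Prop) t1 t2 : dfn (fun v => Q (v 0%N) (v 1%N)) ->
  dterm t1 -> dterm t2 -> dfn (fun v => Q (t1 v) (t2 v)).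
Proof.
move=> hQ h1 h2.
apply: (@dfn_iff (fun v => exists x, x = t1 v /\ exists y, y = t2 v /\ Q x y)).
  move=> v; split=> [[x [-> [y [->]]]]//|h].
  by exists (t1 v); split=> //; exists (t2 v).
apply: dfn_ex; apply: dfn_and.
  by apply: dfn_eq; [exact: dterm_var | exact: dterm_shift].
apply: (@dfn_ex (fun v y => y = t2 (fun i => v i.+1) /\ Q (v 0%N) y)).
apply: dfn_and.
  apply: dfn_eq; first exact: dterm_var.
  exact: (dterm_shift (dterm_shift h2)).
exact: (@dfn_ren _ (fun i => if i is 0 then 1%N else 0%N) hQ).
Qed.

Lemma dfn_subst3 (Q : R -> R -> R -> Prop) t1 t2 t3 :
  dfn (fun v => Q (v 0%N) (v 1%N) (v 2%N)) ->
  dterm t1 -> dterm t2 -> dterm t3 -> dfn (fun v => Q (t1 v) (t2 v) (t3 v)).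
Proof.
move=> hQ h1 h2 h3.
apply: (@dfn_iff (fun v => exists x, x = t1 v /\ exists y, y = t2 v /\
  exists z, z = t3 v /\ Q x y z)).
  move=> v; split=> [[x [-> [y [-> [z [->]]]]]]//|h].
  by exists (t1 v); split=> //; exists (t2 v); split => //; exists (t3 v).
apply: dfn_ex; apply: dfn_and.
  by apply: dfn_eq; [exact: dterm_var | exact: dterm_shift].
apply: (@dfn_ex (fun v y => y = t2 (fun i => v i.+1) /\ exists z,
   z = t3 (fun i => v i.+1) /\ Q (v 0%N) y z)).
apply: dfn_and.
  apply: dfn_eq; first exact: dterm_var.
  exact: (dterm_shift (dterm_shift h2)).
apply: (@dfn_ex (fun v z => z = t3 (fun i => v i.+2) /\ Q (v 1%N) (v 0%N) z)).
apply: dfn_and.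
  apply: dfn_eq; first exact: dterm_var.
  exact: (dterm_shift (dterm_shift (dterm_shift h3))).
exact: (@dfn_ren _ (fun i => if i is 0 then 2%N else if i is 1 then 1%N else 0%N) hQ).
Qed.

Lemma dfn_W1 : dfn (fun v => A (v 0%N, v 1%N, v 2%N)).
Proof. by exists (FW1 (TVar 0) (TVar 1) (TVar 2)), [::] => v. Qed.

Lemma dfn_W2 : dfn (fun v => B (v 0%N, v 1%N, v 2%N)).
Proof. by exists (FW2 (TVar 0) (TVar 1) (TVar 2)), [::] => v. Qed.

Lemma dfn_all_ltn (N : nat) (P : nat -> (nat -> R) -> Prop) :
  (forall i, (i < N)%N -> dfn (P i)) -> dfn (fun v => forall i, (i < N)%N -> P i v).
Proof.
elim: N => [_|N IHN hP].
  apply: (@dfn_iff (fun v => v 0%N = v 0%N)) => //.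
  by apply: dfn_eq; exact: dterm_var.
apply: dfn_iff (dfn_and (IHN (fun i hi => hP i (ltnW hi))) (hP N (ltnSn N))) => v.
split=> [[h hN] i|h]; last by split=> [i hi|]; apply: h => //; exact: ltnW.
by rewrite ltnS leq_eqVlt => /orP[/eqP -> //|]; exact: h.
Qed.

(** [definable] puts the coordinates before the parameters and [pre] does the reverse. The renaming
    exchanges the two blocks; an index beyond both reads 0 on either side. *)
Lemma definable_of_dfn n (X : set 'rV[R]_n) P : dfn P ->
  (forall x : 'rV[R]_n, X x <-> P (nth 0 [seq x ord0 i | i <- enum 'I_n])) ->
  definable A B X.
Proof.
move=> [f [b hf]] hX.
exists (ren (fun i => if (i < size b)%N then (n + i)%N
  else if (i < size b + n)%N then (i - size b)%N else i) f), b.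
apply/seteqP; suff h x : X x <-> sat A B ([seq x ord0 i | i <- enum 'I_n] ++ b)
   (ren (fun i => if (i < size b)%N then (n + i)%N
  else if (i < size b + n)%N then (i - size b)%N else i) f).
  by split=> x /h.
rewrite hX hf -fsat_nth fsat_ren.
set e := [seq _ | _ <- _]; suff -> : pre b (nth 0 e) = nth 0 (e ++ b) \o
  (fun i => if (i < size b)%N then (n + i)%N
  else if (i < size b + n)%N then (i - size b)%N else i) by [].
have se : size e = n by rewrite size_map size_enum_ord.
apply/funext => i; rewrite /pre /= nth_cat se; case: (ltnP i (size b)) => hi.
  by rewrite ltnNge leq_addr /= addKn.
case: (ltnP i (size b + n)) => hi2; first by rewrite ltn_subLR ?hi2.
have hn : (n <= i)%N by exact: leq_trans (leq_addl _ _) hi2.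
by rewrite ltnNge hn /= [LHS]nth_default ?[RHS]nth_default // ?se leq_subRL // addnC.
Qed.

End Definability.

(** * Digits *)

Section Digits.
Variable R : realType.

Lemma nested_intervals (l u : nat -> R) : (forall k, l k <= l k.+1) ->
  (forall k, u k.+1 <= u k) -> (forall k, l k <= u k) ->
  exists x, forall k, l k <= x <= u k.
Proof.
move=> hl hu hlu.
have/nondecreasing_seqP ml := hl; have/nonincreasing_seqP mu := hu.
have lu i j : l i <= u j.
  apply: le_trans (ml _ _ (leq_maxl i j)) _.
  exact: le_trans (hlu _) (mu _ _ (leq_maxr i j)).
have hs : has_sup (range l).
  split; first by exists (l 0%N), 0%N.
  by exists (u 0%N) => _ [i _ <-].
exists (sup (range l)) => k; apply/andP; split.
  by apply: ub_le_sup; [exact: hs.2 | exists k].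
by apply: ge_sup; [exact: hs.1 | move=> _ [i _ <-]].
Qed.

Variable q : nat.
Hypothesis q_ge2 : (2 <= q)%N.
Local Notation Q := (q%:R : R).

Let Q_gt0 : 0 < Q.
Proof. by rewrite ltr0n; lia. Qed.

Let Q_gt1 : 1 < Q.
Proof. by rewrite ltr1n; lia. Qed.

Let Q_neq0 : Q != 0.
Proof. exact: lt0r_neq0. Qed.

(** Cutting the expansion after the place $q^{-m}$ leaves an integer multiple of $q^{-m}$ with last
    digit $k$. The upper bound is not strict because all later digits may be $q-1$. *)
Lemma V_digit (x : R) (m k : nat) : 0 < x -> (k < q)%N ->
  V q (x, Q ^- m, k%:R) ->
  exists M : nat, [/\ (M %% q)%N = k, M%:R <= Q ^+ m * x & Q ^+ m * x <= M.+1%:R].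
Proof.
move=> x0 kq [p [a [n [[ap ai cv] np /= en ek]]]].
have nE : n = - m%:Z.
  apply: (@ieexprIz _ Q) => //; first by rewrite gt_eqF.
  by rewrite -en exprnN.
have ak : a n = k by apply/eqP; rewrite -(eqr_nat R) -ek.
(* [h N] is the integer spelled by the sign digit and the next $N$ digits; the $N$-th partial sum is
   $h_N q^{p-N}$. *)
pose h := fix h (N : nat) : int :=
  if N is N'.+1 then q%:Z * h N' + (a (p%:Z - 1 - N'%:Z))%:Z else - (a p)%:Z.
have QS N : Q ^ (p%:Z - N%:Z) = Q * Q ^ (p%:Z - 1 - N%:Z).
  by rewrite -[X in X * _]expr1z -expfzDr //; congr exprz; ring.
have QS' N : Q ^ (p%:Z - N.+1%:Z) = Q ^ (p%:Z - 1 - N%:Z).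
  by congr exprz; rewrite -addn1 PoszD; ring.
have uE N : - ((a p)%:R * Q ^ p%:Z) + \sum_(0 <= j < N)
    (a (p%:Z - 1 - j%:Z))%:R * Q ^ (p%:Z - 1 - j%:Z) = (h N)%:~R * Q ^ (p%:Z - N%:Z).
  elim: N => [|N IHN]; first by rewrite big_geq //= addr0 subr0 mulrNz mulNr.
  rewrite big_nat_recr //= addrA IHN (QS N) QS' intrD intrM; ring.
have QP i : 0 < Q ^ i by exact: exprz_gt0.
have aq (N : nat) : (a (p%:Z - 1 - N%:Z)%R < q)%N by apply: ai; lia.
rewrite /= in cv; set u := (fun N : nat => _) in cv.
have lS N : (h N)%:~R * Q ^ (p%:Z - N%:Z) <= (h N.+1)%:~R * Q ^ (p%:Z - N.+1%:Z).
  rewrite (QS N) QS' mulrA ler_pM2r // -[Q]/((q%:Z)%:~R) -intrM ler_int /=.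
  by rewrite mulrC lerDl.
have uS N : (h N.+1 + 1)%:~R * Q ^ (p%:Z - N.+1%:Z) <= (h N + 1)%:~R * Q ^ (p%:Z - N%:Z).
  rewrite (QS N) QS' mulrA ler_pM2r // -[Q]/((q%:Z)%:~R) -intrM ler_int /=.
  have := aq N; set b := a _; set g := h N; lia.
have/nondecreasing_seqP ml := lS; have/nonincreasing_seqP mu := uS.
have cvu : cvgn u by apply/cvg_ex; exists x.
have lb N : (h N)%:~R * Q ^ (p%:Z - N%:Z) <= x.
  rewrite -(cvg_lim _ cv) //; apply: limr_ge => //; near=> N'.
  rewrite /u uE; apply: ml; near: N'; exact: nbhs_infty_ge.
have ub N : x <= (h N + 1)%:~R * Q ^ (p%:Z - N%:Z).
  rewrite -(cvg_lim _ cv) //; apply: limr_le => //; near=> N'.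
  rewrite /u uE; apply: (@le_trans _ _ ((h N' + 1)%:~R * Q ^ (p%:Z - N'%:Z))).
    by rewrite ler_pM2r // ler_int lerDl.
  apply: mu; near: N'; exact: nbhs_infty_ge.
have {lb}lb := lb (p + m)%N; have {ub}ub := ub (p + m)%N.
have eQ : Q ^ (p%:Z - (p + m)%N%:Z) = Q ^- m.
  by rewrite exprnN; congr exprz; rewrite PoszD; ring.
move: lb ub; rewrite eQ => lb ub.
have h0 : 0 <= h (p + m)%N.
  have : 0 < (h (p + m)%N + 1)%:~R * Q ^- m by exact: lt_le_trans ub.
  by rewrite pmulr_lgt0 ?invr_gt0 ?exprn_gt0 // ltr0z ltzD1.
exists `|h (p + m)%N|%N; split.
- move: h0; case E : (p + m)%N => [|N1] /=.
    (* Here the digit in question is the sign digit itself, and $h \ge 0$ forces it to be 0. *)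
    have [p0 m0] : p = 0%N /\ m = 0%N by lia.
    have nep : n = p by rewrite nE p0 m0 oppr0.
    rewrite oppr_ge0 lez_nat leqn0 => /eqP a0.
    by rewrite -ak nep a0 oppr0 mod0n.
  have -> : p%:Z - 1 - N1%:Z = n by lia.
  rewrite ak; case: (h N1) => [g _|g].
    by rewrite -PoszM -PoszD absz_nat mulnC modnMDl modn_small.
  rewrite NegzE; lia.
- rewrite -(@ler_pM2r _ (Q ^- m)) ?invr_gt0 ?exprn_gt0 //.
  rewrite mulrAC mulfV ?expf_neq0 // mul1r.
  by rewrite -[X in X%:R * _]/(`|_|%N) natr_absz ger0_norm.
- rewrite -(@ler_pM2r _ (Q ^- m)) ?invr_gt0 ?exprn_gt0 //.
  rewrite mulrAC mulfV ?expf_neq0 // mul1r -natr1 natr_absz ger0_norm //.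
  by rewrite intrD in ub.
Unshelve. all: end_near.
Qed.

(** Integers [F j] within one unit below $q^j x$ are the truncations of an expansion of $x$ whose
    digits are $F_{j+1} - qF_j$. *)
Lemma digit_W (x : R) (F : nat -> nat) (m : nat) : 0 <= x <= 1 -> (F 0 <= 1)%N ->
  (forall j, (q * F j <= F j.+1 < q * F j + q)%N) ->
  (forall j, (F j)%:R <= Q ^+ j * x <= (F j).+1%:R) ->
  W q (x, Q ^- m, (F m %% q)%:R).
Proof.
move=> x01 F0 FS FE; split; last first.
  split; last by exists (F m %% q)%N => //=; rewrite ltn_mod; lia.
  by split; [rewrite /= in_itv | exists m].
(* The sign digit 0 sits at $p = 1$, since [F 0] may be 1 and needs an ordinary place 0. The
   argument of [dg] is $1-i$ for the place $i$. *)
pose dg j := if j is j'.+1 then if j' is i.+1 then (F i.+1 - q * F i)%N else F 0%N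
             else 0%N.
pose a (i : int) := dg `|1 - i|%N.
have aE (j : nat) : a (1 - 1 - j%:Z) = dg j.+1.
  by rewrite /a; congr dg; lia.
exists 1%N, a, (- m%:Z); split; first split.
- by left.
- move=> i i1; rewrite /a; case: `|1 - i|%N => [|[|j]] /=; try lia.
  have := FS j; lia.
- rewrite /a subrr absz0 /= mul0r oppr0.
  have E N : \sum_(0 <= j < N.+1) (a (1%:Z - 1 - j%:Z))%:R * Q ^ (1%:Z - 1 - j%:Z)
     = (F N)%:R / Q ^+ N.
    elim: N => [|N IHN]; first by rewrite big_nat1 aE !subrr expr0z expr0 divr1 mulr1.
    rewrite big_nat_recr // IHN aE /= subrr sub0r -exprnN.
    have /andP[h _] := FS N.
    rewrite natrB // natrM exprS invfM.
    by field; rewrite expf_neq0 //= Q_neq0.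
  rewrite /=.
  apply/cvgrPdist_le => e e0.
  have := @cvg_geometric R 1 Q^-1.
  rewrite ger0_norm ?invr_ge0 ?ltW // invf_lt1 // => /(_ Q_gt1).
  move=> /cvgrPdist_le /(_ e e0) [N0 _ hN0]; exists N0.+1 => // -[//|N] /hN0 /=.
  rewrite !add0r E.
  rewrite /geometric /= mul1r normrN exprVn ger0_norm ?invr_ge0 ?exprn_ge0 ?(ltW Q_gt0) //.
  move=> he; apply: le_trans he.
  have QN : 0 < Q ^+ N by rewrite exprn_gt0.
  have /andP[l1 l2] := FE N.
  rewrite -(@ler_pM2r _ (Q ^+ N)) // mulVf ?gt_eqF // -{2}(ger0_norm (ltW QN)) -normrM.
  rewrite mulrBl divfK ?gt_eqF // ler_norml; move: l1 l2; rewrite -natr1.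
  by set X := _ * x; rewrite mulrC -/X => l1 l2; apply/andP; split; lra.
- by lia.
- by rewrite /= exprnN.
- rewrite /= /a opprK; case: m => [|m]; first by rewrite modn_small //=; lia.
  have -> : absz (1 + m.+1%:Z) = m.+2 by lia.
  rewrite /=; have /andP[h1 h2] := FS m; congr _%:R.
  rewrite -{1}(subnKC h1) mulnC modnMDl modn_small //; lia.
Qed.


(** At most two integers $M$ qualify, and two only if $q^m x$ is an integer. They belong to the
    expansions obtained from the floors of $q^j x$ and from the ceilings minus one. *)
Lemma WP (x : R) (m k : nat) : 0 < x <= 1 -> (k < q)%N ->
  W q (x, Q ^- m, k%:R) <->
  exists M : nat, [/\ (M %% q)%N = k, M%:R <= Q ^+ m * x & Q ^+ m * x <= M.+1%:R].
Proof.
move=> /andP[x0 x1] kq; split; first by case=> h _; exact: V_digit.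
case=> M [Mk lM uM].
have QP j : 0 < Q ^+ j by exact: exprn_gt0.
have Qx j : 0 < Q ^+ j * x by exact: mulr_gt0.
have Qle j : Q ^+ j * x <= Q ^+ j by rewrite ger_pMr.
have [hM|hM] := ltP (Q ^+ m * x) M.+1%:R.
  pose F j := Num.trunc (Q ^+ j * x).
  have FE j : (F j)%:R <= Q ^+ j * x < (F j).+1%:R.
    exact/truncn_itv/ltW.
  rewrite -Mk (_ : M = F m); last by apply/esym/truncn_def; rewrite lM hM.
  apply: digit_W; first by rewrite ltW.
  - rewrite -ltnS -(ltr_nat R); apply: le_lt_trans (andP (FE 0)).1 _.
    by rewrite expr0 mul1r; apply: le_lt_trans x1 _; rewrite ltr1n.
  - move=> j; have /andP[a1 a2] := FE j; have /andP[b1 b2] := FE j.+1.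
    rewrite exprS -mulrA in b1 b2.
    apply/andP; split.
      rewrite -ltnS -(ltr_nat R) natrM; apply: le_lt_trans b2.
      by rewrite ler_pM2l.
    rewrite -(ltr_nat R); apply: le_lt_trans b1 _.
    by rewrite natrD natrM -[X in _ + X]mulr1 -mulrDr ltr_pM2l // natr1.
  - by move=> j; have /andP[-> /ltW ->] := FE j.
have {hM}lM' : M%:R < Q ^+ m * x by apply: lt_le_trans hM; rewrite ltr_nat.
(* Now $q^m x = M+1$, so $M$ is the ceiling minus one. *)
pose F j := `|Num.ceil (Q ^+ j * x) - 1|%N.
have FE j : (F j)%:R < Q ^+ j * x <= (F j).+1%:R.
  have := ceil_itv (Q ^+ j * x).
  have : 0 < Num.ceil (Q ^+ j * x) by rewrite ceil_gt0.
  rewrite /F; case: (Num.ceil _) => // -[//|c] _.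
  have -> : absz (c.+1%:Z - 1) = c by lia.
  by have -> : c.+1%:Z - 1 = c by lia.
have FM : F m = M.
  have /andP[a1 a2] := FE m.
  have c1 := lt_le_trans a1 uM; have c2 := lt_le_trans lM' a2.
  by move: c1 c2; rewrite !ltr_nat; lia.
rewrite -Mk -FM; apply: digit_W; first by rewrite ltW.
- rewrite -ltnS -(ltr_nat R); apply: lt_le_trans (andP (FE 0)).1 _.
  by rewrite expr0 mul1r; apply: le_trans x1 _; rewrite ler1n.
- move=> j; have /andP[a1 a2] := FE j; have /andP[b1 b2] := FE j.+1.
  rewrite exprS -mulrA in b1 b2.
  apply/andP; split.
    rewrite -ltnS -(ltr_nat R) natrM; apply: lt_le_trans b2.
    by rewrite ltr_pM2l.
  rewrite -(ltr_nat R); apply: lt_le_trans b1 _.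
  by rewrite natrD natrM -[X in _ + X]mulr1 -mulrDr ler_pM2l // natr1.
- by move=> j; have /andP[/ltW -> ->] := FE j.
Qed.

(* Two different digits at the place [u] mean that [x] is a multiple of [u]: this
   makes divisibility by powers of [q] first order.  The clause [0 < x] excludes
   the second expansion 1...1*11... of 0 in base 2. *)
Definition amb (x u : R) : Prop :=
  0 < x /\ exists k, exists k', k <> k' /\ (W q (x, u, k) /\ W q (x, u, k')).

Lemma W_range (x u k : R) : W q (x, u, k) ->
  [/\ 0 <= x <= 1, exists m, u = Q ^- m & exists2 d, (d < q)%N & k = d%:R].
Proof.
case=> _ [[]] /=; rewrite in_itv /= => x01 [m _ <-] [d dq <-]; split=> //.
  by exists m.
by exists d.
Qed.

(** Different digits come from different $M < M'$, and the two closed unit intervals can only share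
    the integer $M'$. Conversely $M$ and $M-1$ have different residues because $q \ge 2$. *)
Lemma ambP (x u : R) : amb x u <->
  exists m M : nat, [/\ u = Q ^- m, 0 < x <= 1 & Q ^+ m * x = M%:R].
Proof.
split.
  move=> [x0 [k [k' [kk' [h h']]]]].
  have [/andP[_ x1] [m um] [d dq kd]] := W_range h.
  have [_ _ [d' dq' kd']] := W_range h'.
  have x01 : 0 < x <= 1 by rewrite x0.
  rewrite um kd in h; rewrite um kd' in h'.
  case: (WP m x01 dq).1 => // M [Md l1 u1].
  case: (WP m x01 dq').1 => // M' [Md' l2 u2].
  have : (M < M')%N || (M' < M)%N.
    rewrite -neq_ltn; apply/eqP => eM; apply: kk'.
    by rewrite kd kd' -Md -Md' eM.
  case/orP => hM.
  - exists m, M'; split=> //; apply/eqP; rewrite eq_le l2 andbT.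
    by apply: le_trans u1 _; rewrite ler_nat.
  - exists m, M; split=> //; apply/eqP; rewrite eq_le l1 andbT.
    by apply: le_trans u2 _; rewrite ler_nat.
move=> [m [M [-> x01 hM]]]; have /andP[x0 x1] := x01; split=> //.
have q0 : (0 < q)%N by lia.
have M0 : (0 < M)%N by rewrite -(ltr_nat R) -hM mulr_gt0 // exprn_gt0.
exists (M %% q)%:R, (M.-1 %% q)%:R; split; last split.
- move=> /eqP; rewrite eqr_nat -{1}(prednK M0) -addn1 -{2}[M.-1]addn0 eqn_modDl.
  by rewrite !modn_small.
- apply/WP => //; first by rewrite ltn_mod.
  by exists M; rewrite hM !ler_nat leqnSn.
- apply/WP => //; first by rewrite ltn_mod.
  by exists M.-1; rewrite hM prednK // !ler_nat leq_pred.
Qed.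

Lemma W_trunc (x : R) (m k : nat) : 0 < x <= 1 -> (k < q)%N ->
  (forall M : nat, Q ^+ m * x <> M%:R) ->
  W q (x, Q ^- m, k%:R) <-> (Num.trunc (Q ^+ m * x) %% q)%N = k.
Proof.
move=> x01 kq hx; rewrite WP //.
have Qx : 0 <= Q ^+ m * x.
  by case/andP: x01 => /ltW x0 _; rewrite mulr_ge0 // exprn_ge0 // ler0n.
split=> [[M [Mk l1 u1]]|<-].
  rewrite (@truncn_def _ _ M) // l1 /= lt_neqAle u1 andbT.
  by apply/eqP; exact: hx.
have /andP[l1 /ltW u1] := truncn_itv Qx.
by exists (Num.trunc (Q ^+ m * x)).
Qed.

(** The expansion with digit 1 exactly on [S] works: a later digit 1 keeps $q^m x$ off the integer
    below, a later digit 0 off the integer above, so every digit is unique. Place 0 is left out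
    since its digit is 0. *)
Lemma W_set (S : nat -> Prop) : ~ S 0%N ->
  (forall n, exists2 m, (n < m)%N & S m) -> (forall n, exists2 m, (n < m)%N & ~ S m) ->
  exists x : R, 0 < x <= 1 /\ forall m, W q (x, Q ^- m, 1) <-> S m.
Proof.
move=> S0 Sinf Scoinf.
pose d m : nat := `[< S m >].
pose F := fix F (m : nat) : nat := if m is m'.+1 then (q * F m' + d m)%N else 0%N.
have QP j : 0 < Q ^+ j by exact: exprn_gt0.
have QS j : (Q ^+ j)^-1 = Q * (Q ^+ j.+1)^-1.
  by rewrite exprS invfM mulVKf.
pose l m : R := (F m)%:R / Q ^+ m.
pose u m : R := (F m).+1%:R / Q ^+ m.
have d1 m : (d m <= 1)%N by rewrite /d; case: asbool.
have lS i : l i <= l i.+1.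
  by rewrite /l (QS i) mulrA ler_pM2r ?invr_gt0 // -natrM ler_nat /= mulnC leq_addr.
have uS k : u k.+1 <= u k.
  rewrite /u (QS k) mulrA ler_pM2r ?invr_gt0 // -natrM ler_nat /=.
  by have := d1 k.+1; move: (F k) (d k.+1) => a b; nia.
have lu k : l k <= u k by rewrite ler_pM2r ?invr_gt0 // ler_nat.
have [x hx] := nested_intervals lS uS lu.
have ml := (nondecreasing_seqP _).1 lS.
have mu := (nonincreasing_seqP _).1 uS.
have lx k : l k < x.
  have [m km Sm] := Sinf k; apply: lt_le_trans (andP (hx m)).1.
  case: m km Sm => // m km Sm; apply: le_lt_trans (ml k m km) _.
  rewrite /l (QS m) mulrA ltr_pM2r ?invr_gt0 // -natrM ltr_nat /= /d asboolT //.
  by move: (F m) => a; lia.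
have ux k : x < u k.
  have [m km Sm] := Scoinf k; apply: le_lt_trans (andP (hx m)).2 _.
  case: m km Sm => // m km Sm; apply: lt_le_trans (mu k m km).
  rewrite /u (QS m) mulrA ltr_pM2r ?invr_gt0 // -natrM ltr_nat /= /d asboolF //.
  by move: (F m) => a; nia.
have x0 : 0 < x by have := lx 0%N; rewrite /l mul0r.
have x1 : x <= 1 by have := ltW (ux 0%N); rewrite /u expr0 divr1.
have trE m : (F m)%:R < Q ^+ m * x < (F m).+1%:R.
  have := lx m; have := ux m; rewrite /l /u ltr_pdivrMr // ltr_pdivlMr //.
  by rewrite [x * _]mulrC => -> ->.
exists x; split; first by rewrite x0.
move=> m; have /andP[t1 t2] := trE m.
rewrite -[1]/(1%:R) W_trunc ?x0 //; last first.
  move=> M hM; rewrite hM !ltr_nat in t1 t2; lia.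
rewrite (@truncn_def _ _ (F m)) ?(ltW t1) //.
case: m {t1 t2} => [|m] /=; first by rewrite mod0n.
rewrite mulnC modnMDl modn_small; last by have := d1 m.+1; lia.
by rewrite /d; case: asboolP.
Qed.

End Digits.

(** * Automation for definability *)

Ltac dterm_tac := solve [repeat first
  [exact: dterm_var | exact: dterm_cst | apply: dterm_add | apply: dterm_muln]].

(** Follows connectives, real quantifiers and comparisons of terms; atoms such as [W] and [amb]
    remain as goals. *)
Ltac dfn_step := cbv beta; lazymatch goal with
  | |- dfn _ _ (fun v => _ /\ _) => apply: dfn_and
  | |- dfn _ _ (fun v => _ \/ _) => apply: dfn_or
  | |- dfn _ _ (fun v => ~ _) => apply: dfn_not
  | |- dfn _ _ (fun v => exists x, _) => apply: dfn_ex
  | |- dfn _ _ (fun v => _ = _) => apply: dfn_eq; dterm_tac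
  | |- dfn _ _ (fun v => is_true (_ < _)) => apply: dfn_lt; dterm_tac
  | |- dfn _ _ (fun v => is_true (_ <= _)) => apply: dfn_le; dterm_tac
  | |- dfn _ _ (fun v => forall x : Real.sort _, _) => apply: dfn_all
  | |- dfn _ _ (fun v => _ -> _) => apply: dfn_imp
  end.

Ltac dfn_tac := repeat dfn_step.

(** * Coding binary relations on the natural numbers *)

Section Coding.
Variable R : realType.
Variables A B : set (R * R * R).
Variable q : nat.
Hypothesis q_ge2 : (2 <= q)%N.
Hypothesis dfn_W : dfn A B (fun v => W q (v 0%N, v 1%N, v 2%N)).
Local Notation Q := (q%:R : R).

Lemma dfn_Wt t1 t2 t3 : dterm t1 -> dterm t2 -> dterm t3 ->
  dfn A B (fun v => W q (t1 v, t2 v, t3 v)).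
Proof. exact: (dfn_subst3 (Q := fun x u k => W q (x, u, k))). Qed.

Lemma dfn_amb t1 t2 : dterm t1 -> dterm t2 ->
  dfn A B (fun v => amb q (t1 v) (t2 v)).
Proof.
apply: dfn_subst2; rewrite /amb.
by dfn_tac; apply: dfn_Wt; dterm_tac.
Qed.

Lemma expVn_lt (m n : nat) : (Q ^- m < Q ^- n) = (n < m)%N.
Proof.
have Q1 : 1 < Q by rewrite ltr1n; lia.
by rewrite ltf_pV2 ?posrE ?exprn_gt0 ?(lt_trans ltr01) // ltr_eXn2l.
Qed.

Lemma expVn_le (m n : nat) : (Q ^- m <= Q ^- n) = (n <= m)%N.
Proof. by rewrite leNgt expVn_lt -leqNgt. Qed.

Lemma expVn_inj (m n : nat) : Q ^- m = Q ^- n -> m = n.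
Proof. by move=> /eqP; rewrite eq_le !expVn_le => /andP[] *; lia. Qed.

Variables (e : nat -> R) (Rho : R -> R -> Prop) (O : nat -> nat -> Prop).
Hypothesis dfn_Rho : dfn A B (fun v => Rho (v 0%N) (v 1%N)).
Hypothesis Rho_e : forall x y, Rho x y -> exists n, y = e n.
Hypothesis RhoE : forall c n, Rho (Q ^- c) (e n) <-> O n c.
Hypothesis O_fun : forall n n' c, O n c -> O n' c -> n = n'.
Hypothesis O_inf : forall n N, exists c, (N < c)%N /\ O n c.

(** A pair of [T] is stored as two consecutive labels $c_{2t}, c_{2t+1}$ whose images under [Rho]
    are its components. The formula takes a label $u$ from the even set [x0] and the next label $u'$
    from the odd set [x1]. *)
Lemma dfn_relation (T : nat -> nat -> Prop) :
  dfn A B (fun v => exists n m, [/\ T n m, v 0%N = e n & v 1%N = e m]).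
Proof.
have [[n0 [m0 T0]]|noT] := pselect (exists n m, T n m); last first.
  apply: (@dfn_iff _ _ _ (fun v => v 0%N < v 0%N)); last by dfn_tac.
  by move=> v; rewrite ltxx; split=> // -[n [m [h _ _]]]; case: noT; exists n, m.
(* An enumeration of [T]; the default pair [(n0, m0)] keeps every value inside [T]. *)
pose pr t : nat * nat := if unpickle t is Some p then
  if `[< T p.1 p.2 >] then p else (n0, m0) else (n0, m0).
have prT t : T (pr t).1 (pr t).2.
  by rewrite /pr; case: unpickle => // p; case: asboolP.
have prS n m : T n m -> exists t, pr t = (n, m).
  by move=> h; exists (pickle (n, m)); rewrite /pr pickleK asboolT.
pose nn k := if odd k then (pr k./2).2 else (pr k./2).1.
have [g hg] := choice (fun p : nat * nat => O_inf p.1 p.2).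
(* Each label exceeds the previous one by at least 2, so the successor of a label is never a label.
   This gives the infinite complement that [W_set] asks for. *)
pose c := fix c k := if k is k'.+1 then g (nn k, (c k').+1) else g (nn 0%N, 0%N).
have cS k : ((c k).+1 < c k.+1)%N := (hg (nn k.+1, (c k).+1)).1.
have cO k : O (nn k) (c k).
  by case: k => [|k]; [exact: (hg (nn 0%N, 0%N)).2 | exact: (hg (nn k.+1, (c k).+1)).2].
have c0 : (0 < c 0)%N := (hg (nn 0%N, 0%N)).1.
clearbody c.
have cmono i j : (i < j)%N -> ((c i).+1 < c j)%N.
  elim: j => // j IHj; rewrite ltnS leq_eqVlt => /orP[/eqP -> //|/IHj h].
  by have := cS j; lia.
have cinj i j : (c i < c j)%N -> (i < j)%N.
  by move=> h; case: (ltngtP i j) => // [/cmono|eij]; [lia | rewrite eij ltnn in h].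
have cge k : (k < c k)%N by elim: k => // k IHk; have := cS k; lia.
have cgap i j : c i <> (c j).+1.
  by case: (ltngtP i j) => [/cmono|/cmono|->]; lia.
have set_of (b : bool) : exists x : R, forall m,
    W q (x, Q ^- m, 1) <-> exists t, m = c (t.*2 + b)%N.
  have [|||x [_ hx]] := @W_set R q q_ge2 (fun m => exists t, m = c (t.*2 + b)%N).
  - by move=> [t ht]; have := cge (t.*2 + b)%N; rewrite -ht.
  - move=> n; exists (c (n.*2 + b)%N); last by exists n.
    by have := cge (n.*2 + b)%N; lia.
  - move=> n; exists (c n).+1; first by have := cge n; lia.
    by move=> [t] /esym; exact: cgap.
  - by exists x.
have [x0 hx0] := set_of false; have [x1 hx1] := set_of true.
have W_exp x u : W q (x, u, 1 : R) -> exists m, u = Q ^- m.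
  by move=> /(W_range)[].
(* Larger exponents mean smaller powers: [u'] is the largest element of [x1] below [u], which is the
   odd label right after [u]. *)
apply: (@dfn_iff _ _ _ (fun v => exists u, exists u', W q (x0, u, 1) /\
    (W q (x1, u', 1) /\ (u' < u /\ ((forall w, W q (x1, w, 1) -> w < u -> w <= u') /\
    (Rho u (v 0%N) /\ Rho u' (v 1%N))))))).
  move=> v; split.
    move=> [u [u' [Wu [Wu' [u'u [nxt [r0 r1]]]]]]].
    have [n vn] := Rho_e r0; have [m vm] := Rho_e r1.
    exists n, m; split=> //.
    have [a ua] := W_exp _ _ Wu; have [a' ua'] := W_exp _ _ Wu'.
    move: Wu Wu' r0 r1; rewrite ua ua' vn vm hx0 hx1 !RhoE => -[t ta] [t' ta'].
    subst a a' u u'; rewrite expVn_lt in u'u.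
    have := nxt (Q ^- c (t.*2 + true)%N).
    rewrite hx1 expVn_lt expVn_le => nxt1 r0 r1.
    have h1 : (c (t'.*2 + true) <= c (t.*2 + true))%N.
      by apply: nxt1; [exists t | apply: ltnW; apply: cmono; rewrite ltn_add2l].
    have tt' : t' = t.
      have := cinj _ _ u'u; move: h1; case: (ltngtP (t.*2 + true) (t'.*2 + true))%N.
      - by move=> /cmono; lia.
      - by lia.
      - by lia.
    subst t'.
    have E0 := cO (t.*2 + false)%N; have E1 := cO (t.*2 + true)%N.
    rewrite /nn addn0 odd_double doubleK in E0.
    rewrite /nn addn1 /= odd_double /= uphalf_double in E1.
    rewrite addn0 in r0; rewrite addn1 in r1.
    by rewrite (O_fun r0 E0) (O_fun r1 E1).
  move=> [n [m [Tnm -> ->]]]; have [t ht] := prS _ _ Tnm.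
  exists (Q ^- c t.*2), (Q ^- c t.*2.+1); rewrite hx0 hx1 !RhoE expVn_lt.
  have E0 := cO t.*2; have E1 := cO t.*2.+1.
  rewrite /nn odd_double doubleK ht /= in E0.
  rewrite /nn /= odd_double /= uphalf_double ht /= in E1.
  split; first by exists t; rewrite addn0.
  split; first by exists t; rewrite addn1.
  split; first exact: ltnW (cmono _ _ _).
  split=> // w Ww; have [a wa] := W_exp _ _ Ww; subst w.
  move: Ww; rewrite hx1 expVn_lt expVn_le => -[t' ->] /cinj h.
  case: (ltngtP t.*2.+1 (t'.*2 + true)%N) => [/cmono|h'|->//]; lia.
dfn_tac; try (apply: dfn_Wt; dterm_tac); by apply: (dfn_subst2 dfn_Rho); dterm_tac.
Qed.

End Coding.

(** * Definable sequences of reals *)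

Section Sequences.
Variable R : realType.
Variables A B : set (R * R * R).
Variables (s K : nat).
Hypothesis s_ge2 : (2 <= s)%N.
Hypothesis K_gt0 : (0 < K)%N.
Hypothesis dfn_W : dfn A B (fun v => W s (v 0%N, v 1%N, v 2%N)).
Local Notation S := (s%:R : R).
Local Notation e n := (S ^- (K * n.+1)).
Hypothesis dfn_rel : forall T : nat -> nat -> Prop,
  dfn A B (fun v => exists n m, [/\ T n m, v 0%N = e n & v 1%N = e m]).

Lemma dfn_index (G : nat -> Prop) : dfn A B (fun v => exists n, G n /\ v 0%N = e n).
Proof.
apply: (@dfn_iff _ _ _ (fun v => exists n m, [/\ n = m /\ G n, v 0%N = e n & v 0%N = e m])).
  move=> v; split=> [[n [m [[_ Gn] ? _]]]|[n [Gn h]]]; first by exists n.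
  by exists n, n.
have := dfn_ren (fun=> 0%N) (dfn_rel (fun n m => n = m /\ G n)); exact.
Qed.

Lemma trunc_divn (t : R) : 0 <= t -> (Num.trunc (S * t) %/ s)%N = Num.trunc t.
Proof.
move=> t0; have S0 : 0 < S by rewrite ltr0n; lia.
have /andP[l1 u1] := truncn_itv t0.
have /andP[l2 u2] := truncn_itv (mulr_ge0 (ltW S0) t0).
have h1 : (s * Num.trunc t < (Num.trunc (S * t)).+1)%N.
  by rewrite -(ltr_nat R) natrM; apply: le_lt_trans u2; rewrite ler_pM2l.
have h2 : (Num.trunc (S * t) < s * (Num.trunc t).+1)%N.
  by rewrite -(ltr_nat R) natrM; apply: le_lt_trans l2 _; rewrite ltr_pM2l.
have s0 : (0 < s)%N by lia.
apply/eqP; rewrite eqn_leq -ltnS ltn_divLR // leq_divRL //.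
by rewrite mulnC h2 mulnC -ltnS h1.
Qed.

(** Equal digits give equal integer parts of $s^m x$ and $s^m y$, hence $|x-y| \le s^{-m}$ for all
    $m$. *)
Lemma digits_inj (x y : R) : 0 <= x < 1 -> 0 <= y < 1 ->
  (forall m, (Num.trunc (S ^+ m.+1 * x) %% s = Num.trunc (S ^+ m.+1 * y) %% s)%N) ->
  x = y.
Proof.
move=> /andP[x0 x1] /andP[y0 y1] h.
have S0 : 0 < S by rewrite ltr0n; lia.
have SP m : 0 < S ^+ m by exact: exprn_gt0.
have E m : Num.trunc (S ^+ m * x) = Num.trunc (S ^+ m * y).
  elim: m => [|m IHm].
    by rewrite expr0 !mul1r (@truncn_def _ x 0) ?(@truncn_def _ y 0) ?x0 ?y0.
  rewrite (divn_eq (Num.trunc (S ^+ m.+1 * x)) s) h.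
  rewrite [RHS](divn_eq (Num.trunc (S ^+ m.+1 * y)) s).
  by rewrite exprS -!mulrA !trunc_divn ?IHm // mulr_ge0 // ltW.
have D m : S ^+ m * `|x - y| <= 1.
  rewrite -{1}(ger0_norm (ltW (SP m))) -normrM mulrBr.
  have /andP[l1 u1] := truncn_itv (mulr_ge0 (ltW (SP m)) x0).
  have /andP[l2 u2] := truncn_itv (mulr_ge0 (ltW (SP m)) y0).
  rewrite -E in l2 u2; move: u1 u2; rewrite -natr1 => u1 u2.
  by rewrite ler_norml; apply/andP; split; lra.
apply/eqP; rewrite -subr_eq0 -normr_eq0; apply/eqP; apply: contrapT => /eqP ne0.
have d0 : 0 < `|x - y| by rewrite lt_def ne0 normr_ge0.
pose m := Num.trunc (`|x - y|^-1).
have /andP[_ um] := truncn_itv (ltW (eq_ind_r is_true d0 (invr_gt0 `|x - y|))).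
have mS : m.+1%:R <= S ^+ m.+1 :> R by rewrite -natrX ler_nat; apply/ltnW/ltn_expl.
have := D m.+1; apply/negP; rewrite -ltNge.
by apply: lt_le_trans (_ : m.+1%:R * `|x - y| <= _);
  [rewrite -ltr_pdivrMr // div1r | rewrite ler_pM2r].
Qed.

(** For fixed $i < K$ and $d < s$, that $z_n$ has digit $d$ at place $K(m+1)-i$ is a relation
    between $n$ and $m$, hence definable. Finitely many such relations prescribe all digits, and the
    clause on [amb] makes the digits of the candidate unique. *)
Lemma dfn_seq (z : nat -> R) : (forall n, 0 < z n < 1) ->
  (forall n m M : nat, S ^+ m * z n <> M%:R) ->
  dfn A B (fun v => exists n, v 0%N = e n /\ v 1%N = z n).
Proof.
move=> z01 zna.
have S0 : 0 < S by rewrite ltr0n; lia.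
pose dg n p := (Num.trunc (S ^+ p * z n) %% s)%N.
have dgs n p : (dg n p < s)%N by rewrite ltn_mod; lia.
have z01' n : 0 < z n <= 1 by have /andP[-> /ltW ->] := z01 n.
have pos i m : (i < K)%N -> (S ^- (K * m.+1)) *+ s ^ i = S ^- (K * m.+1 - i) :> R.
  move=> iK; have le : (i <= K * m.+1)%N by nia.
  rewrite -(mulr_natl _ (s ^ i)) natrX -{1}(subnK le) exprD invfM mulrCA mulfV ?mulr1 //.
  by rewrite expf_neq0 // gt_eqF.
apply: (@dfn_iff _ _ _ (fun v => (exists n, True /\ v 0%N = e n) /\ (0 < v 1%N /\
  ((forall u, ~ amb s (v 1%N) u) /\ forall u, forall i, (i < K)%N -> forall d, (d < s)%N ->
   (exists n m, [/\ dg n (K * m.+1 - i)%N = d, v 0%N = e n & u = e m]) ->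
   W s (v 1%N, u *+ s ^ i, d%:R))))).
  move=> v; split.
    move=> [[n [_ vn]] [v1 [na dig]]]; exists n; split=> //.
    have W0 (m : nat) : W s (v 1%N, S ^- m.+1, (dg n m.+1)%:R).
      (* Every positive place is reached from a multiple of $K$ by fewer than $K$ multiplications by
         $s$. *)
      have [r0 [m0 [rK hr]]] : exists i m0, (i < K)%N /\ m.+1 = (K * m0.+1 - i)%N.
        exists (K - 1 - m %% K)%N, (m %/ K)%N; split; first by lia.
        have := divn_eq m K; have : (m %% K < K)%N by rewrite ltn_mod.
        by nia.
      rewrite hr -(pos _ _ rK); apply: (dig _ _ rK _ (dgs _ _)).
      by exists n, m0; split.
    have v01 : 0 < v 1%N <= 1.
      by have [/andP[_ ->]] := W_range (W0 0%N); rewrite v1.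
    have na' (m M : nat) : S ^+ m * v 1%N <> M%:R.
      by move=> h; apply: (na (S ^- m)); apply/(ambP s_ge2); exists m, M; split.
    apply: digits_inj.
    - case/andP: v01 => /ltW -> le1; rewrite lt_neqAle le1 andbT.
      by apply/eqP => h; apply: (na' 0%N 1%N); rewrite expr0 mul1r.
    - by have /andP[/ltW -> ->] := z01 n.
    - by move=> m; have := W0 m; rewrite W_trunc.
  move=> [n [v0 v1]]; rewrite v0 v1; split; first by exists n.
  split; first by have /andP[] := z01 n.
  split.
    by move=> u /(ambP s_ge2) [m [M [_ _]]]; exact: zna.
  move=> u i iK d ds [n' [m [hd en ->]]].
  have nn' : n' = n by move/(expVn_inj s_ge2): en; nia.
  by rewrite pos // W_trunc // -hd nn'.
apply: dfn_and; first exact: dfn_index.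
dfn_tac; first by apply: (dfn_amb dfn_W); dterm_tac.
apply: dfn_all; cbv beta. apply: dfn_all_ltn => i iK; apply: dfn_all_ltn => d ds.
dfn_tac; last by apply: (dfn_Wt dfn_W); dterm_tac.
exact: (dfn_subst2 (Q := fun x y => exists n m,
    [/\ dg n (K * m.+1 - i)%N = d, x = e n & y = e m])
  (dfn_rel (fun n m => dg n (K * m.+1 - i)%N = d)) (dterm_var _ 1) (dterm_var _ 0)).
Qed.

End Sequences.

(** * Compact sets *)

Section Compact.
Variable R : realType.
Variables A B : set (R * R * R).
Variable e : nat -> R.
Hypothesis e_inj : injective e.
Hypothesis dfn_index : forall G : nat -> Prop,
  dfn A B (fun v => exists n, G n /\ v 0%N = e n).
Hypothesis dfn_seq : forall z : nat -> R, (forall n, 0 < z n < 1) ->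
  (forall n, irrational (z n)) ->
  dfn A B (fun v => exists n, v 0%N = e n /\ v 1%N = z n).
Variable zeta : R.
Hypothesis zeta01 : 0 < zeta < 1.
Hypothesis zeta_irr : irrational zeta.

Lemma irrational_addq (x : R) (c : rat) : irrational x -> irrational (x + ratr c).
Proof.
move=> hx [a _ ha]; apply: hx; exists (a - c) => //.
by rewrite rmorphB /= ha addrK.
Qed.

(* Interval endpoints are taken irrational so that their digits are unique. *)
Definition endpoint (c : rat) : R :=
  if 0 < zeta + ratr c < 1 then zeta + ratr c else zeta.

Lemma endpoint01 c : 0 < endpoint c < 1.
Proof. by rewrite /endpoint; case: ifP. Qed.

Lemma endpoint_irr c : irrational (endpoint c).
Proof.
by rewrite /endpoint; case: ifP => _ //; exact: irrational_addq.
Qed.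

(** Rational translates of [zeta] are dense, and those falling in $(0,1)$ are endpoints. *)
Lemma endpoint_dense (x y : R) : 0 <= x -> y <= 1 -> x < y ->
  exists c, x < endpoint c < y.
Proof.
move=> x0 y1 xy.
have /rat_in_itvoo [c] : x - zeta < y - zeta by rewrite ltrD2r.
rewrite in_itv /= => /andP[h1 h2]; exists c; rewrite /endpoint ifT; lra.
Qed.

(** Inside a large open cube, the complement of [X] is the union of the countably many coded boxes
    that miss [X]. The formula says that the point lies in the cube and in none of these boxes. *)
Lemma definable_compact n (X : set 'rV[R]_n) : compact X -> definable A B X.
Proof.
move=> cX.
have clX : closed X by apply: compact_closed => //; exact: norm_hausdorff.
have [N hN] : exists N : nat, forall x, X x -> forall i, `|x ord0 i| < N%:R.
  have [M [_ hM]] := compact_bounded cX.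
  exists (Num.trunc (`|M| + 1)).+1 => x Xx i.
  have /andP[_ hu] := truncn_itv (addr_ge0 (normr_ge0 M) ler01).
  apply: le_lt_trans hu.
  have : `|x| <= `|M| + 1 by apply: hM => //; rewrite (le_lt_trans (ler_norm _)) // ltrDl.
  apply: le_trans; rewrite [leRHS]/Num.Def.normr /= mx_normrE.
  by apply/bigmax_geP; right; exists (ord0, i).
(* Endpoints live in $(0,1)$; $z \mapsto Cz - N$ carries them to $(-N,N)$. *)
pose C := (2 * N)%N.
(* A number that codes no list still yields a box, which is harmless because only [good] boxes are
   used. *)
pose bx k : seq (rat * rat) := if unpickle k is Some b then b else [::].
pose lo (i k : nat) := endpoint (nth (0, 0) (bx k) i).1.
pose hi (i k : nat) := endpoint (nth (0, 0) (bx k) i).2.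
pose inb k (x : 'rV[R]_n) := forall i : 'I_n,
   lo i k *+ C < x ord0 i + N%:R /\ x ord0 i + N%:R < hi i k *+ C.
pose good k := forall x, inb k x -> ~ X x.
pose bet i (u x : R) := exists z, (exists k, u = e k /\ z = lo i k) /\
  exists z', (exists k, u = e k /\ z' = hi i k) /\
  (z *+ C < x + N%:R /\ x + N%:R < z' *+ C).
have dbet i : dfn A B (fun v => bet i (v 0%N) (v 1%N)).
  rewrite /bet; dfn_tac.
    apply: (dfn_subst2 (Q := fun u z => exists k, u = e k /\ z = lo i k)); try dterm_tac.
    by apply: dfn_seq => k; [exact: endpoint01 | exact: endpoint_irr].
  apply: (dfn_subst2 (Q := fun u z => exists k, u = e k /\ z = hi i k)); try dterm_tac.
  by apply: dfn_seq => k; [exact: endpoint01 | exact: endpoint_irr].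
have betE i k x : bet i (e k) x <->
    lo i k *+ C < x + N%:R /\ x + N%:R < hi i k *+ C.
  split=> [[z [[k1 [/e_inj <- ->]] [z' [[k2 [/e_inj <- ->]]]]]]//|h].
  by exists (lo i k); split; [exists k | exists (hi i k); split => //; exists k].
apply: (@definable_of_dfn _ _ _ _ _ (fun v =>
   (forall i, (i < n)%N -> 0 < v i + N%:R /\ v i + N%:R < N%:R + N%:R) /\
   forall u, (exists k, good k /\ u = e k) ->
     ~ forall i, (i < n)%N -> bet i u (v i))).
  apply: dfn_and; first by apply: dfn_all_ltn => i _; dfn_tac.
  apply: dfn_all; cbv beta; apply: dfn_imp; first exact: (dfn_index good).
  apply: dfn_not; apply: dfn_all_ltn => i _.
  by apply: (dfn_subst2 (dbet i)); dterm_tac.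
move=> x.
have nthE (i : 'I_n) : nth 0 [seq x ord0 i | i <- enum 'I_n] i = x ord0 i.
  by rewrite (nth_map i) ?size_enum_ord // nth_ord_enum.
split=> [Xx|[xN hx]].
  split=> [i ni|_ [k [gk ->]] h].
    have := hN _ Xx (Ordinal ni); rewrite (nthE (Ordinal ni)) ltr_norml => /andP[]; lra.
  apply: (gk x) => // i; have := h _ (ltn_ord i); rewrite nthE => /betE //.
apply: contrapT => nX.
have [eps eps0 hb] : exists2 eps, 0 < eps & ball x eps `<=` ~` X.
  have : nbhs x (~` X) by apply: open_nbhs_nbhs; split=> //; exact: closed_openC.
  by move=> /nbhs_ballP [eps eps0 h]; exists eps.
(* In each coordinate, endpoints closer than [eps] on both sides of $x$ give a box around $x$ inside
   the ball. *)
have coord (i : 'I_n) : exists c : rat * rat,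
    [/\ x ord0 i + N%:R - eps < endpoint c.1 *+ C, endpoint c.1 *+ C < x ord0 i + N%:R,
        x ord0 i + N%:R < endpoint c.2 *+ C & endpoint c.2 *+ C < x ord0 i + N%:R + eps].
  have [] := xN i (ltn_ord i); rewrite nthE; set y := x ord0 i + _ => y0 yN.
  have CE : C%:R = N%:R + N%:R :> R by rewrite -natrD addnn -mul2n.
  have C0 : 0 < C%:R :> R by rewrite CE; exact: lt_trans yN.
  have [|||c1 /andP[a1 a2]] := @endpoint_dense (Num.max 0 ((y - eps) / C%:R)) (y / C%:R).
  - by rewrite le_max lexx.
  - by rewrite ler_pdivrMr // mul1r CE ltW.
  - rewrite gt_max divr_gt0 //= ltr_pM2r ?invr_gt0 //; lra.
  have [|||c2 /andP[b1 b2]] := @endpoint_dense (y / C%:R) (Num.min 1 ((y + eps) / C%:R)).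
  - by rewrite divr_ge0 ?ltW.
  - by rewrite ge_min lexx.
  - rewrite lt_min ltr_pdivrMr // mul1r CE yN -CE ltr_pM2r ?invr_gt0 //; lra.
  exists (c1, c2) => /=; move: a1 a2 b1 b2.
  rewrite gt_max lt_min => /andP[_ a1] a2 b1 /andP[_ b2].
  have mE c : endpoint c *+ C = endpoint c * C%:R by rewrite mulr_natr.
  rewrite !mE.
  by split; rewrite -?ltr_pdivrMr // -?ltr_pdivlMr.
have [c hc] := choice coord.
pose k := pickle [seq c i | i <- enum 'I_n].
have bxk (i : 'I_n) : nth (0, 0) (bx k) i = c i.
  by rewrite /bx pickleK (nth_map i) ?size_enum_ord // nth_ord_enum.
apply: (hx (e k)).
  exists k; split=> // y yk; apply: hb.
  split=> // i j; rewrite (ord1 i); have [h1 h2 h3 h4] := hc j.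
  have [] := yk j; rewrite /lo /hi bxk => g1 g2.
  by rewrite /ball /= ltr_norml; apply/andP; split; lra.
move=> i ni; have [h1 h2 h3 h4] := hc (Ordinal ni).
by apply/betE; rewrite /lo /hi (bxk (Ordinal ni)) (nthE (Ordinal ni)).
Qed.

End Compact.

(** * A prime of [s] that does not divide [r] *)

Section NewPrime.
Variable R : realType.
Variables A B : set (R * R * R).
Variables (r s p : nat).
Hypotheses (r_ge2 : (2 <= r)%N) (s_ge2 : (2 <= s)%N).
Hypotheses (p_pr : prime p) (p_s : (p %| s)%N) (p_r : ~~ (p %| r)%N).
Hypothesis dfn_Wr : dfn A B (fun v => W r (v 0%N, v 1%N, v 2%N)).
Hypothesis dfn_Ws : dfn A B (fun v => W s (v 0%N, v 1%N, v 2%N)).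
Local Notation Rr := (r%:R : R).
Local Notation S := (s%:R : R).

Let r_gt0 : 0 < Rr. Proof. by rewrite ltr0n; lia. Qed.
Let s_gt0 : 0 < S. Proof. by rewrite ltr0n; lia. Qed.

(* [s^-n - s^-n'] is not a multiple of [r^-m], because of the prime [p]. *)
Lemma separation (n n' m : nat) (z : int) : (n < n')%N ->
  S ^- n' * Rr ^- m <= `|S ^- n - S ^- n' - z%:~R * Rr ^- m|.
Proof.
move=> nn'.
pose D : int := (r ^ m * (s ^ (n' - n) - 1))%N%:Z - z * (s ^ n')%N%:Z.
have sP k : (0 < s ^ k)%N by rewrite expn_gt0; lia.
have SP k : 0 < S ^+ k by exact: exprn_gt0.
have RP k : 0 < Rr ^+ k by exact: exprn_gt0.
have E : S ^- n - S ^- n' - z%:~R * Rr ^- m = D%:~R * (S ^- n' * Rr ^- m).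
  have en : S ^+ n' = S ^+ (n' - n) * S ^+ n by rewrite -exprD subnK // ltnW.
  rewrite /D intrD intrN intrM -!pmulrn natrM natrB // !natrX en.
  by field; rewrite !expf_neq0 ?gt_eqF.
have D0 : D != 0.
  apply/eqP => /eqP; rewrite subr_eq0 => /eqP eD.
  have : (p %| r ^ m * (s ^ (n' - n) - 1))%N.
    have -> : (r ^ m * (s ^ (n' - n) - 1))%N = (`|z| * s ^ n')%N.
      by have := congr1 absz eD; rewrite abszM !absz_nat.
    by rewrite dvdn_mull // (dvdn_trans p_s) // dvdn_exp //; lia.
  rewrite Euclid_dvdM // => /orP[]; first by rewrite Euclid_dvdX // (negPf p_r).
  have ps : (p %| s ^ (n' - n))%N by rewrite (dvdn_trans p_s) // dvdn_exp // subn_gt0.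
  rewrite (dvdn_subr (sP _) ps) dvdn1.
  by move=> /eqP p1; move: p_pr; rewrite p1.
rewrite E normrM (ger0_norm (_ : 0 <= S ^- n' * Rr ^- m)); last first.
  by rewrite mulr_ge0 // invr_ge0 ltW.
rewrite ler_peMl ?mulr_ge0 ?invr_ge0 ?(ltW (SP _)) ?(ltW (RP _)) //.
by rewrite -intr_norm ler1z; lia.
Qed.

(** The factor $4^j$ makes the places sparse; the factor $s$ makes $m_j + 1$ never a place and gives
    $a_j \le b_j$. As a 2-adic valuation, [h] takes every value infinitely often. *)
Let m j := (s * 4 ^ j)%N.
Let a j : R := Rr ^- m j.
Let h j := logn 2 j.+1.
Let b j : R := S ^- (h j).+1.

Lemma double_expVn k : 2 * Rr ^- k.+1 <= Rr ^- k.
Proof.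
rewrite exprS invfM mulrA ger_pMl ?invr_gt0 ?exprn_gt0 //.
by rewrite ler_pdivrMr // mul1r ler_nat.
Qed.

Lemma m_ge2 j : (2 <= m j)%N.
Proof. by rewrite /m; have := expn_gt0 4 j; nia. Qed.

Lemma m_mono i j : (i < j)%N -> (4 * m i <= m j)%N.
Proof.
by move=> ij; rewrite /m mulnCA -expnS leq_mul2l leq_exp2l // ij orbT.
Qed.

Lemma m_lt i j : (i < j)%N -> (m i < m j)%N.
Proof. by move=> /m_mono; have := m_ge2 i; lia. Qed.

Lemma m_inj i j : m i = m j -> i = j.
Proof. by case: (ltngtP i j) => // /m_lt; lia. Qed.

Lemma m_gt j : (j < m j)%N.
Proof. by rewrite /m; have := ltn_expl j (isT : 1 < 4)%N; nia. Qed.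

(** The bound is $a_i^2$, the precision at which [separation] distinguishes powers of $s$ that are
    at least $a_i$. *)
Lemma a_small i j : (i < j)%N -> 2 * a j < Rr ^- (2 * m i).
Proof.
move=> ij; have mm := m_mono ij; have m2 := m_ge2 i.
have mE : m j = (m j).-1.+1 by lia.
rewrite /a mE; apply: le_lt_trans (double_expVn _) _.
by rewrite expVn_lt //; lia.
Qed.

Lemma a_gt0 j : 0 < a j.
Proof. by rewrite invr_gt0 exprn_gt0. Qed.

(* Stage [j] moves [y] up by at most [a j] so that [b j - y] becomes a multiple
   of [a j]; later stages perturb this by at most [2 * a j.+1]. *)
Let step y j : R := b j + (Num.floor ((y - b j) / a j) + 1)%:~R * a j.
Let yy := fix yy (j : nat) : R := if j is i.+1 then step (yy i) i else 0.

Lemma step_itv y j : y < step y j <= y + a j.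
Proof.
have := floor_itv ((y - b j) / a j); rewrite /step.
set f := Num.floor _; rewrite ler_pdivlMr ?a_gt0 // ltr_pdivrMr ?a_gt0 //.
by rewrite intrD mulr1z mulrDl mul1r => /andP[f1 f2]; apply/andP; split; lra.
Qed.

(** The intervals $[y_j, y_j + 2a_j]$ are nested, since stage $j$ moves by at most $a_j$ and
    $2a_{j+1} \le a_j$. *)
Lemma limit_point : exists y : R, 0 < y <= 1 / 2 /\ forall j,
  [/\ 0 < yy j.+1 & yy j.+1 <= y <= yy j.+1 + 2 * a j.+1].
Proof.
have yS j : yy j < yy j.+1 by have /andP[] := step_itv (yy j) j.
have lS j : yy j <= yy j.+1 by exact: ltW.
have uS j : yy j.+1 + 2 * a j.+1 <= yy j + 2 * a j.
  have /andP[_ h1] := step_itv (yy j) j; have := a_small (ltnSn j).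
  have : Rr ^- (2 * m j) <= a j by rewrite /a expVn_le //; lia.
  by rewrite /=; lra.
have lu j : yy j <= yy j + 2 * a j by have := a_gt0 j; lra.
have [y hy] := nested_intervals lS uS lu.
have y0 j : 0 < yy j.+1.
  elim: j => [|j IHj]; first exact: (yS 0%N).
  exact: lt_trans (yS j.+1).
exists y; split; last by move=> j; split.
have /andP[_ h0] := hy 0%N; have /andP[h1 _] := hy 1%N.
rewrite (lt_le_trans (y0 0%N) h1) /=; apply: le_trans h0 _; rewrite add0r.
have mE : m 0%N = (m 0%N).-1.+1 by have := m_ge2 0; lia.
rewrite /a mE; apply: le_trans (double_expVn _) _.
apply: (@le_trans _ _ (Rr ^- 1)).
  by rewrite expVn_le //; have := m_ge2 0; lia.
by rewrite expr1 div1r lef_pV2 ?posrE // ler_nat.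
Qed.

(** The map to be fed into [dfn_relation] sends $a_j$ to the only power $w \ge a_j$ of $s$ for which
    $w - y$ is extremely close to a multiple of $a_j$, namely $b_j$. *)
Lemma dfn_relation_new_prime (T : nat -> nat -> Prop) :
  dfn A B (fun v => exists n k, [/\ T n k, v 0%N = S ^- (1 * n.+1)
    & v 1%N = S ^- (1 * k.+1)]).
Proof.
have [y [/andP[y0 y12] hy]] := limit_point.
have [|||x [_ hx]] := @W_set R r r_ge2 (fun c => exists j, c = m j).
- by move=> [j hj]; have := m_ge2 j; rewrite -hj.
- by move=> n; exists (m n); [exact: m_gt | exists n].
- move=> n; exists (m n).+1; first by have := m_gt n; lia.
  (* All places are multiples of $s \ge 2$, so $m_n + 1$ is not one. *)
  move=> [j]; rewrite /m => hj.
  have : (s %| (s * 4 ^ n).+1)%N by rewrite hj dvdn_mulr.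
  by rewrite -addn1 dvdn_addr ?dvdn_mulr // dvdn1; lia.
(* [amb s 1 w] says that [w] is a power of $s$. The multiple of [u] is a difference $t - t'$ because
   [amb] only sees $(0,1]$; it exceeds $w - y$ by at most $2u'$ for a later place [u']. *)
pose Rho (u w : R) := W r (x, u, 1) /\ (amb s 1 w /\ (w < 1 /\ (u <= w /\
  exists u', W r (x, u', 1) /\ (u' < u /\ exists t, exists t',
    amb r t u /\ (amb r t' u /\ (w + t' <= t + y /\ t + y <= w + t' + (u' + u'))))))).
have RhoE u w : Rho u w -> exists j n (z : int), [/\ u = a j, w = S ^- n.+1,
    a j <= S ^- n.+1 & 0 <= z%:~R * a j - (w - y) < Rr ^- (2 * m j)].
  move=> [Wu [/(ambP s_ge2) [n [_ [wn _ _]]] [w1 [uw [u' [Wu' [u'u H]]]]]]].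
  have [_ [c uc] _] := W_range Wu; have [_ [c' uc'] _] := W_range Wu'.
  move: Wu Wu'; rewrite uc uc' !hx => -[j cj] [j' cj']; subst c c' u u'.
  have {}u'u : (j < j')%N.
    move: u'u; rewrite expVn_lt // /m ltn_mul2l => /andP[_].
    by rewrite ltn_exp2l.
  case: n wn w1 => [->|n wn _]; first by rewrite expr0 invr1 ltxx.
  move: H => [t [t' [/(ambP r_ge2)[c [M [/(expVn_inj r_ge2) <- _ tM]]]]]].
  move=> [/(ambP r_ge2)[c' [M' [/(expVn_inj r_ge2) <- _ tM']]] [l1 l2]].
  exists j, n, (M%:Z - M'%:Z); split=> //; first by rewrite -wn.
  have rj : Rr ^+ m j != 0 by rewrite expf_neq0 // gt_eqF.
  have -> : (M%:Z - M'%:Z)%:~R * a j = t - t'.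
    by rewrite intrB -!pmulrn -tM -tM' /a; field.
  have := a_small u'u; rewrite /a => aj.
  by apply/andP; split; lra.
have Rho_fun u w w' : Rho u w -> Rho u w' -> w = w'.
  move=> /RhoE [j [n [z [-> wn an hz]]]] /RhoE [j' [n' [z' [ej wn' an' hz']]]].
  have jj' : j' = j by move/(expVn_inj r_ge2): ej => /m_inj.
  subst j'.
  (* Subtracting two such approximations leaves an error below $a_j^2 \le s^{-k'} a_j$, against
     [separation]. *)
  have key k k' (y1 y2 : int) : (k < k')%N -> a j <= S ^- k' ->
      0 <= y1%:~R * a j - (S ^- k - y) < Rr ^- (2 * m j) ->
      0 <= y2%:~R * a j - (S ^- k' - y) < Rr ^- (2 * m j) -> False.
    move=> kk' ak /andP[h1 h2] /andP[h3 h4].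
    have := separation (m j) (y1 - y2) kk'; apply/negP; rewrite -ltNge.
    apply: (@lt_le_trans _ _ (Rr ^- (2 * m j))).
      rewrite -/(a j) intrB mulrBl ltr_norml.
      by apply/andP; split; lra.
    have -> : Rr ^- (2 * m j) = a j * a j by rewrite mul2n -addnn exprD invfM.
    by rewrite -/(a j) ler_pM2r ?a_gt0.
  case: (ltngtP n.+1 n'.+1) => [nn|nn|[nn]]; last by rewrite wn wn' nn.
    by case: (key _ _ z z' nn an'); rewrite -?wn -?wn'.
  by case: (key _ _ z' z nn an); rewrite -?wn -?wn'.
have Rho_dfn : dfn A B (fun v => Rho (v 0%N) (v 1%N)).
  rewrite /Rho; dfn_tac; try (apply: (dfn_Wt dfn_Wr); dterm_tac);
  try (apply: (dfn_amb dfn_Wr); dterm_tac); by apply: (dfn_amb dfn_Ws); dterm_tac.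
apply: (@dfn_relation _ _ _ r r_ge2 dfn_Wr _ Rho
  (fun n c => Rho (Rr ^- c) (S ^- (1 * n.+1)))) => //.
- by move=> u w /RhoE [j [n [z [_ -> _ _]]]]; exists n; rewrite mul1n.
- move=> n n' c h1 h2; have := Rho_fun _ _ _ h1 h2; rewrite !mul1n.
  by move/(expVn_inj s_ge2); lia.
(* The odd cofactor $2N+1$ gives $j+1$ the valuation $n$ and makes $j \ge N$. *)
move=> n N; pose j := (2 ^ n * N.*2.+1).-1.
have jE : j.+1 = (2 ^ n * N.*2.+1)%N by rewrite prednK // muln_gt0 expn_gt0.
have hj : h j = n.
  rewrite /h jE lognM ?expn_gt0 // lognX (@logn_prime 2 2) // muln1.
  by rewrite lognE /= dvdn2 /= odd_double /= addn0.
have jN : (N <= j)%N by rewrite -ltnS jE; have := expn_gt0 2 n; nia.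
have nj : (n <= j)%N.
  by rewrite -ltnS jE; have := ltn_expl n (isT : 1 < 2)%N; nia.
exists (m j); split; first exact: leq_ltn_trans (m_gt j).
have bE : b j = S ^- (1 * n.+1) by rewrite /b hj mul1n.
have b0 : 0 < b j by rewrite invr_gt0 exprn_gt0.
have b12 : b j <= 1 / 2.
  rewrite /b; apply: (@le_trans _ _ (S ^- 1)); first by rewrite expVn_le.
  by rewrite expr1 div1r lef_pV2 ?posrE // ler_nat.
have a14 : a j <= 1 / 4.
  rewrite /a; apply: (@le_trans _ _ (Rr ^- 2)); first by rewrite expVn_le // m_ge2.
  rewrite div1r lef_pV2 ?posrE ?exprn_gt0 // -natrX ler_nat.
  by rewrite (leq_exp2r 2 r (isT : (0 < 2)%N)).
rewrite -bE -/(a j); split; first by rewrite hx; exists j.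
split.
  apply/(ambP s_ge2); exists (h j).+1, (s ^ (h j).+1)%N; split=> //.
    by rewrite ltr01 lexx.
  by rewrite mulr1 natrX.
split; first by lra.
split.
  rewrite /a /b lef_pV2 ?posrE ?exprn_gt0 // -!natrX ler_nat hj.
  apply: (@leq_trans (2 ^ (s * n.+1))); first by rewrite expnM leq_exp2r // ltnW // ltn_expl.
  apply: (@leq_trans (2 ^ m j)); last by rewrite leq_exp2r // ltnW // m_ge2.
  by rewrite leq_exp2l // /m leq_mul2l (leq_trans _ (ltn_expl j _)) ?orbT // ltnS.
have [yj0 /andP[yj1 yj2]] := hy j.
exists (a j.+1); split; first by rewrite hx; exists j.+1.
split; first by rewrite /a expVn_lt // m_lt.
(* The integer hidden in [step]: $b_j - y_{j+1} = Z a_j$. *)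
pose Z : int := - (Num.floor ((yy j - b j) / a j) + 1).
have ZE : Z%:~R * a j = b j - yy j.+1.
  by rewrite /= /step /Z intrN mulNr opprD addrA subrr add0r.
have aj := a_gt0 j.
have rj : Rr ^+ m j != 0 by rewrite expf_neq0 // gt_eqF.
have aK : Rr ^+ m j * a j = 1 by rewrite mulfV.
have ambM (M : nat) : (0 < M)%N -> M%:R * a j <= 1 -> amb r (M%:R * a j) (a j).
  move=> M0 M1; apply/(ambP r_ge2); exists (m j), M; split=> //.
    by rewrite M1 mulr_gt0 // ltr0n.
  by rewrite mulrCA aK mulr1.
have amb1 : amb r (a j) (a j).
  by have := ambM 1%N isT; rewrite mul1r; apply; lra.
have ZSE : `|Z|%N.+1%:R * a j = `|Z|%N%:R * a j + a j.
  by rewrite -(natr1 `|Z|%N) mulrDl mul1r.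
(* $Z a_j$ is written as $t - t'$ with one extra $a_j$ in both, which keeps them positive; the
   bounds $1/2$ and $1/4$ keep them at most 1. *)
have [z0|z0] := leP 0 Z.
  have Za : `|Z|%N%:R * a j = b j - yy j.+1 by rewrite -ZE natr_absz ger0_norm.
  exists (`|Z|%N.+1%:R * a j), (a j).
  split; first by apply: ambM => //; rewrite ZSE Za; lra.
  by split=> //; rewrite ZSE Za; split; lra.
have Za : `|Z|%N%:R * a j = yy j.+1 - b j.
  by rewrite -opprB -ZE natr_absz ltr0_norm // intrN mulNr.
exists (a j), (`|Z|%N.+1%:R * a j); split=> //.
split; first by apply: ambM => //; rewrite ZSE Za; lra.
by rewrite ZSE Za; split; lra.
Qed.

End NewPrime.

(** * Every prime of [s] divides [r] *)

(** With $p$ maximising $v_p(s)/v_p(r)$ over the primes of $s$, take $L = 2v_p(r)$ and $G =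
    2v_p(s)$. Maximality gives the divisibility, and the valuation at $p$ alone gives the minimality
    of $Gn$. The factor 2 makes $L$ even. *)
Lemma exponents_of_primes (r s : nat) : (2 <= r)%N -> (2 <= s)%N ->
  {subset primes s <= primes r} ->
  exists L G : nat, [/\ (0 < L)%N, ~~ odd L, (s ^ L %| r ^ G)%N &
    forall n m, (s ^ (L * n) %| r ^ m)%N -> (G * n <= m)%N].
Proof.
move=> r2 s2 sr.
have logP q n : (0 < n)%N -> q \in primes n -> prime q /\ (0 < logn q n)%N.
  by move=> n0; rewrite logn_gt0 => h; split=> //; move: h; rewrite mem_primes => /and3P[].
have [s0 r0] : (0 < s)%N /\ (0 < r)%N by lia.
have [p ps pmax] : exists2 p, p \in primes s & forall q, q \in primes s ->
    (logn q s * logn p r <= logn p s * logn q r)%N.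
  have : primes s != [::] by rewrite primes_eq0 -leqNgt.
  have : {subset primes s <= primes s} by [].
  elim: {1 3 4 5}(primes s) => // q l IHl qs _.
  have [qpr ql] := logP q r r0 (sr _ (qs q (mem_head _ _))).
  have [l0|l0] := eqVneq l [::].
    by exists q; rewrite ?mem_head // => q'; rewrite l0 inE => /eqP ->.
  have [|//|p pl pmax] := IHl.
    by move=> q' q'l; apply: qs; rewrite in_cons q'l orbT.
  have [_ pr] := logP p r r0 (sr _ (qs p (mem_behead (s := q :: l) pl))).
  case: (leqP (logn q s * logn p r) (logn p s * logn q r)) => [h|h].
    exists p; first by rewrite in_cons pl orbT.
    by move=> q'; rewrite in_cons => /orP[/eqP ->|/pmax].
  exists q; first exact: mem_head.
  move=> q'; rewrite in_cons => /orP[/eqP -> //|q'l].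
  have h' := pmax _ q'l.
  have [_ qr'] := logP q' r r0 (sr _ (qs q' (mem_behead (s := q :: l) q'l))).
  (* Transitivity of cross-multiplied ratios through $p$, after multiplying by $v_p(r) > 0$. *)
  rewrite -(leq_pmul2r pr).
  have := leq_mul2r (logn q r) (logn q' s * logn p r) (logn p s * logn q' r).
  rewrite h' orbT => h1.
  have := leq_mul2l (logn q' r) (logn p s * logn q r) (logn q s * logn p r).
  rewrite (ltnW h) orbT => h2; nia.
have [p_pr lp] := logP p r r0 (sr _ ps).
exists (2 * logn p r)%N, (2 * logn p s)%N; split.
- by rewrite muln_gt0.
- by rewrite oddM.
- apply/dvdn_partP; first by rewrite expn_gt0 s0.
  move=> q; rewrite pi_of_exp ?muln_gt0 // => qs.
  rewrite p_part pfactor_dvdn ?expn_gt0 ?r0 //; last by have [] := logP q s s0 qs.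
  by rewrite !lognX; have := pmax q qs; nia.
- move=> n m /(dvdn_leq_log p); rewrite expn_gt0 r0 => /(_ isT).
  by rewrite !lognX; nia.
Qed.

(** * The stretching map on exponents and its orbits *)

Section Stretch.
Variables S Q : nat.
Hypotheses (S_ge2 : (2 <= S)%N) (SQ : (2 * S <= Q)%N).

(** $f(n) = \lceil n \log_S Q \rceil$, so that $S^{-f(n)}$ is the largest power of $S$ not above
    $Q^{-n}$. *)
Lemma stretch_exists : exists f : nat -> nat,
  forall n k, (f n <= k)%N = (Q ^ n <= S ^ k)%N.
Proof.
suff h n : exists x, forall k, (x <= k)%N = (Q ^ n <= S ^ k)%N 
  by have [g hg] := choice h; exists g.
have ex : exists k, (Q ^ n <= S ^ k)%N.
  by exists (Q ^ n)%N; apply: ltnW; exact: ltn_expl.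
exists (ex_minn ex); case: ex_minnP => x hx xmin k; apply/idP/idP; last exact: xmin.
by move=> xk; apply: leq_trans hx _; rewrite leq_exp2l.
Qed.

Variable f : nat -> nat.
Hypothesis fE : forall n k, (f n <= k)%N = (Q ^ n <= S ^ k)%N.

Lemma stretch_ub n : (S ^ f n <= S * Q ^ n)%N.
Proof.
case E : (f n) => [|k].
  by have := expn_gt0 Q n; nia.
have : ~~ (f n <= k)%N by rewrite E ltnn.
by rewrite fE -ltnNge expnS leq_mul2l => /ltnW ->; rewrite orbT.
Qed.

Lemma stretch_gt n : (0 < n)%N -> (n < f n)%N.
Proof. by move=> n0; rewrite ltnNge fE -ltnNge ltn_exp2r //; lia. Qed.

(** $S^{f(n)} \le S Q^n < Q^{n+1}$, because $S < Q$. *)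
Lemma stretchS n : (f n < f n.+1)%N.
Proof.
rewrite ltnNge fE -ltnNge; apply: leq_ltn_trans (stretch_ub n) _.
by rewrite expnS ltn_mul2r expn_gt0; lia.
Qed.

Lemma stretch_mono i j : (i < j)%N -> (f i < f j)%N.
Proof.
elim: j => // j IHj; rewrite ltnS leq_eqVlt => /orP[/eqP ->|/IHj h].
  exact: stretchS.
exact: ltn_trans h (stretchS j).
Qed.

Lemma stretch_inj i j : f i = f j -> i = j.
Proof. by case: (ltngtP i j) => // /stretch_mono; lia. Qed.

(** $S^{f(n)+S} \le S Q^n S^S < Q^n (2S)^S \le Q^{n+S}$, since $S < 2^S$. *)
Lemma stretch_gap n : (f n + S < f (n + S))%N.
Proof.
rewrite ltnNge fE -ltnNge !expnD.
apply: (@leq_ltn_trans (S * Q ^ n * S ^ S)); first by rewrite leq_mul2r stretch_ub orbT.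
rewrite [(S * _)%N]mulnC -mulnA ltn_mul2l expn_gt0; apply/andP; split; first by lia.
apply: (@leq_trans ((2 * S) ^ S)); last by rewrite leq_exp2r //; lia.
by rewrite expnMn ltn_mul2r expn_gt0 ltn_expl // andbT; lia.
Qed.

(** Only positive arguments count, as the sets coded later contain positive exponents only; 0 is a
    fixed point of [f]. *)
Definition non_image i := forall j, (0 < j)%N -> f j <> i.

(** If [f] grew by 1 at each of the $S$ steps, [stretch_gap] would fail; right after a value
    followed by a larger jump comes a number outside the image. *)
Lemma non_image_between n : exists i,
  [/\ non_image i, (f n < i)%N & (i < f (n + S))%N].
Proof.
have [t [tS ft]] : exists t, (t < S)%N /\ ((f (n + t)).+1 < f (n + t).+1)%N.
  apply: contrapT => no.
  suff h k : (k <= S)%N -> (f (n + k) <= f n + k)%N.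
    by have := h S (leqnn S); have := stretch_gap n; lia.
  elim: k => [|k IHk] kS; first by rewrite addn0 leq_addr.
  have := IHk (ltnW kS); rewrite addnS.
  case: (leqP (f (n + k).+1) (f (n + k)).+1) => [|h]; first by lia.
  by case: no; exists k.
have hn : (f n <= f (n + t))%N.
  by case: t {tS ft} => [|t]; rewrite ?addn0 // ltnW // stretch_mono //; lia.
have hS : (f (n + t).+1 <= f (n + S))%N.
  have : ((n + t).+1 <= n + S)%N by lia.
  by rewrite leq_eqVlt => /orP[/eqP ->//|/stretch_mono /ltnW].
exists (f (n + t)).+1; split; [|lia|lia].
move=> j _ fj; case: (ltngtP j (n + t)) => [/stretch_mono|h|ej]; [lia| |rewrite ej in fj; lia].
have : ((n + t).+1 <= j)%N by [].
by rewrite leq_eqVlt => /orP[/eqP ej|/stretch_mono]; [rewrite -ej in fj; lia | lia].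
Qed.

(** Seeds of distinct $n$ lie in disjoint intervals, hence differ; taking the least one makes the
    seed definable from $n$. *)
Lemma seed_exists : exists io : nat -> nat, forall n,
  [/\ non_image (io n), (f (S * n) < io n)%N, (io n < f (S * n.+1))%N &
      forall i, non_image i -> (f (S * n) < i)%N -> (io n <= i)%N].
Proof.
suff h n : exists x, [/\ non_image x, (f (S * n) < x)%N, (x < f (S * n.+1))%N &
    forall i, non_image i -> (f (S * n) < i)%N -> (x <= i)%N] 
  by have [g hg] := choice h; exists g.
have [i0 [h1 h2 h3]] := non_image_between (S * n).
have ex : exists i, `[< non_image i >] && (f (S * n) < i)%N.
  by exists i0; rewrite asboolT.
have [x /andP[/asboolP x1 x2] xmin] := ex_minnP ex.
exists x; split=> //; last by move=> i hi fi; apply: xmin; rewrite asboolT.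
by rewrite mulnSr; apply: leq_ltn_trans h3; apply: xmin; rewrite asboolT.
Qed.

(** By injectivity, applications of [f] cancel until one side is a seed, which is no image. *)
Lemma orbit_disjoint i i' a a' : non_image i -> non_image i' -> (0 < i)%N -> (0 < i')%N ->
  iter a f i = iter a' f i' -> i = i'.
Proof.
have pos k x : (0 < x)%N -> (0 < iter k f x)%N.
  by elim: k => // k IHk /IHk h /=; exact: ltn_trans (stretch_gt h).
move=> hi hi' i0 i0'; elim: a a' => [|a IHa] [|a'] //=.
- by move=> e; case: (hi _ (pos a' _ i0')).
- by move=> e; case: (hi' _ (pos a _ i0)).
- by move/stretch_inj; exact: IHa.
Qed.

End Stretch.

(** * Definable orbits on the powers of $s^L$ *)

Section SamePrimes.
Variable R : realType.
Variables A B : set (R * R * R).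
Variables (r s L G : nat).
Hypotheses (r_ge2 : (2 <= r)%N) (s_ge2 : (2 <= s)%N).
Hypotheses (L_gt0 : (0 < L)%N) (L_even : ~~ odd L) (sLrG : (s ^ L %| r ^ G)%N).
Hypothesis LG_min : forall n m, (s ^ (L * n) %| r ^ m)%N -> (G * n <= m)%N.
Hypothesis sLrG_neq : (s ^ L)%N <> (r ^ G)%N.
Hypothesis dfn_Wr : dfn A B (fun v => W r (v 0%N, v 1%N, v 2%N)).
Hypothesis dfn_Ws : dfn A B (fun v => W s (v 0%N, v 1%N, v 2%N)).
Local Notation Rr := (r%:R : R).
Local Notation S := (s%:R : R).
Let S0 := (s ^ L)%N.
Let Q0 := (r ^ G)%N.
Let Er (i : nat) : R := S ^- (L * i).

Let r_gt0 : 0 < Rr. Proof. by rewrite ltr0n; lia. Qed.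
Let s_gt0 : 0 < S. Proof. by rewrite ltr0n; lia. Qed.

Lemma S0_ge2 : (2 <= S0)%N.
Proof. by rewrite /S0; apply: leq_trans s_ge2 _; rewrite -{1}(expn1 s) leq_exp2l. Qed.

Lemma S0_Q0 : (2 * S0 <= Q0)%N.
Proof.
have S2 := S0_ge2; have [[|[|k]] Qk] := dvdnP sLrG.
- by have := expn_gt0 r G; rewrite Qk mul0n; lia.
- by move: Qk; rewrite mul1n => /esym.
- by rewrite /Q0 Qk /S0 leq_mul2r; apply/orP; right.
Qed.

Lemma Er_lt i j : (Er i < Er j) = (j < i)%N.
Proof. by rewrite /Er expVn_lt // ltn_mul2l L_gt0. Qed.

Lemma Er_le i j : (Er i <= Er j) = (j <= i)%N.
Proof. by rewrite leNgt Er_lt -leqNgt. Qed.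

Lemma Er_inj i j : Er i = Er j -> i = j.
Proof. by move=> /eqP; rewrite eq_le !Er_le => /andP[] *; lia. Qed.

(** As $L$ is even, $L(n+1)+1$ is no multiple of $L$, so the set of places has infinite
    complement. *)
Lemma L_set (P : nat -> Prop) : (forall n, exists2 i, (n < i)%N & P i) -> ~ P 0%N ->
  exists x : R, forall u, W s (x, u, 1) <-> exists i, P i /\ u = Er i.
Proof.
move=> Pinf P0.
have [|||x [_ hx]] := @W_set R s s_ge2 (fun c => exists i, P i /\ c = (L * i)%N).
- move=> [i [Pi /esym/eqP]]; rewrite muln_eq0 => /orP[/eqP|/eqP i0]; first by lia.
  by rewrite i0 in Pi.
- move=> n; have [i ni Pi] := Pinf n; exists (L * i)%N; last by exists i.
  by nia.
- move=> n; exists (L * n.+1).+1; first by nia.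
  move=> [i [_ /(congr1 odd)]]; rewrite /= !oddM.
  by move: L_even => /negPf ->.
exists x => u; split.
  move=> Wu; have [_ [c uc] _] := W_range Wu.
  by move: Wu; rewrite uc hx => -[i [Pi ->]]; exists i.
by move=> [i [Pi ->]]; apply/hx; exists i.
Qed.

(** It compares [c'] with the largest power $r^{-m}$ of which [c] is a multiple. *)
Let le_step (c c' : R) := exists u, amb r c u /\ c' <= u.

(** For $c = s^{-Li}$ that power is $r^{-Gi}$: $s^L \mid r^G$ shows that it occurs, [LG_min] that no
    larger one does. *)
Lemma le_stepE i i' : le_step (Er i) (Er i') <-> (Q0 ^ i <= S0 ^ i')%N.
Proof.
have SP k : 0 < S ^+ k by exact: exprn_gt0.
have RP k : 0 < Rr ^+ k by exact: exprn_gt0.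
split.
  move=> [_ [/(ambP r_ge2)[m [M [-> _ hM]]] h]].
  have : (s ^ (L * i) %| r ^ m)%N.
    apply/dvdnP; exists M; apply/eqP; rewrite -(eqr_nat R) natrM !natrX -hM.
    by rewrite divfK // gt_eqF.
  move=> /LG_min hG; rewrite -!expnM.
  apply: (@leq_trans (r ^ m)); first by rewrite leq_exp2l.
  by move: h; rewrite /Er lef_pV2 ?posrE // -!natrX ler_nat.
move=> h; exists (Rr ^- (G * i)); split; last first.
  by rewrite /Er lef_pV2 ?posrE // -!natrX ler_nat !expnM.
have /dvdnP[M hM] : (s ^ (L * i) %| r ^ (G * i))%N by rewrite !expnM dvdn_exp2r.
apply/(ambP r_ge2); exists (G * i)%N, M; split=> //.
  by rewrite invr_gt0 SP /= -[1]invr1 -(expr0 S) expVn_le.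
by rewrite /Er -natrX hM natrM natrX mulfK // gt_eqF.
Qed.

(** [Rho] sends each point of the orbit of the $n$-th seed to its index $S_0^{-S_0(n+1)}$, where
    $S_0 = s^L$. Orbits are infinite and disjoint, so [dfn_relation] applies. *)
Lemma dfn_relation_same_primes (T : nat -> nat -> Prop) :
  dfn A B (fun v => exists n k, [/\ T n k, v 0%N = S ^- ((L * S0) * n.+1)
    & v 1%N = S ^- ((L * S0) * k.+1)]).
Proof.
have S2 := S0_ge2; have SQ := S0_Q0.
have [f fE] := stretch_exists Q0 S2.
have f_gt := stretch_gt S2 SQ fE.
have f0 i : (0 < i)%N -> (0 < f i)%N by move=> i0; exact: ltn_trans (f_gt _ i0).
have [io ioP] := seed_exists S2 SQ fE.
have io0 n : (0 < io n)%N by have [_ h _ _] := ioP n; lia.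
have [|//|xE hE] := @L_set (fun i => (0 < i)%N); first by move=> n; exists n.+1.
have [||xF hF] := @L_set (fun i => exists n, i = (S0 * n.+1)%N).
- by move=> n; exists (S0 * n.+1)%N; [nia | exists n].
- by move=> [n]; nia.
(* The graph of [f] on powers of $S_0$: [c'] is the largest power in [le_step] relation to [c]. *)
pose fR c c' := W s (xE, c, 1) /\ (W s (xE, c', 1) /\ (le_step c c' /\
  forall d, W s (xE, d, 1) -> le_step c d -> d <= c')).
have fRE c c' : fR c c' <-> exists i, [/\ (0 < i)%N, c = Er i & c' = Er (f i)].
  split.
    move=> [/hE [i [i0 ->]] [/hE [j [j0 ->]] [/le_stepE h1 h2]]].
    exists i; split=> //; congr Er; apply/eqP; rewrite eqn_leq fE h1 andbT.
    rewrite -Er_le; apply: h2; first by apply/hE; exists (f i); split=> //; exact: f0.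
    by apply/le_stepE; rewrite -fE.
  move=> [i [i0 -> ->]]; split; first by apply/hE; exists i.
  split; first by apply/hE; exists (f i); split=> //; exact: f0.
  split; first by apply/le_stepE; rewrite -fE.
  by move=> d /hE [j [j0 ->]] /le_stepE; rewrite -fE Er_le.
pose NI p := W s (xE, p, 1) /\ ~ exists c, fR c p.
have NIE p : NI p <-> exists i, [/\ (0 < i)%N, p = Er i & non_image f i].
  split.
    move=> [/hE [i [i0 ->]] no]; exists i; split=> // j j0 ji; apply: no.
    by exists (Er j); apply/fRE; exists j; rewrite ji.
  move=> [i [i0 -> hi]]; split; first by apply/hE; exists i.
  by move=> [c /fRE [j [j0 _ /Er_inj ij]]]; apply: (hi j).
(* The seed of the index [w]: the first non-image exponent beyond the image of [w]. *)
pose iota w p := exists d, fR w d /\ (NI p /\ (p < d /\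
  forall p', NI p' -> p' < d -> p' <= p)).
have iotaE n p : iota (Er (S0 * n.+1)%N) p <-> p = Er (io n.+1).
  have [io1 io2 _ io4] := ioP n.+1.
  split.
    move=> [d [/fRE [i [i0 /Er_inj <- ->]] [/NIE [j [j0 -> nj]]]]].
    rewrite Er_lt => -[fj jmin]; congr Er; apply/eqP; rewrite eqn_leq io4 // andbT.
    rewrite -Er_le; apply: jmin; last by rewrite Er_lt.
    by apply/NIE; exists (io n.+1).
  move=> ->; exists (Er (f (S0 * n.+1)%N)); split.
    by apply/fRE; exists (S0 * n.+1)%N; split=> //; nia.
  split; first by apply/NIE; exists (io n.+1).
  split; first by rewrite Er_lt.
  by move=> _ /NIE [j [j0 -> nj]]; rewrite Er_lt Er_le => fj; exact: io4.
(* [z] codes a set containing [p] and [u] in which every element other than [p] is the image of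
   another element. *)
pose Rho (u w : R) := W s (xE, u, 1) /\ (W s (xF, w, 1) /\ exists p, iota w p /\
  exists z, W s (z, p, 1) /\ (W s (z, u, 1) /\ forall c, W s (xE, c, 1) ->
    W s (z, c, 1) -> c = p \/ exists c0, W s (z, c0, 1) /\ fR c0 c)).
have RhoE u w : Rho u w <-> exists n a, w = Er (S0 * n.+1)%N /\
    u = Er (iter a f (io n.+1)).
  split.
    move=> [Eu [/hF [_ [[n ->] ->]] [p [/iotaE -> [z [zp [zu hz]]]]]]].
    suff h i : (0 < i)%N -> W s (z, Er i, 1) -> exists a, i = iter a f (io n.+1).
      move: Eu zu => /hE [i [i0 ->]] zu; have [a ->] := h i i0 zu.
      by exists n, a.
    (* Preimages under [f] are smaller, so descent inside [z] must end at the seed. *)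
    elim/ltn_ind: i => i IHi i0 zi.
    case: (hz (Er i)) => //; first by apply/hE; exists i.
      by move/Er_inj => ->; exists 0%N.
    move=> [c0 [zc0 /fRE [j [j0 cj /Er_inj ij]]]]; rewrite cj in zc0.
    have ji : (j < i)%N by rewrite ij f_gt.
    by have [a ja] := IHi j ji j0 zc0; exists a.+1; rewrite ij ja.
  move=> [n [a [-> ->]]].
  have it0 k : (0 < iter k f (io n.+1))%N by elim: k => [|k IHk] //=; exact: f0.
  split; first by apply/hE; exists (iter a f (io n.+1)).
  split; first by apply/hF; exists (S0 * n.+1)%N; split=> //; exists n.
  exists (Er (io n.+1)); split; first exact/iotaE.
  (* The witness for [z] is the whole orbit. *)
  have [||z hz] := @L_set (fun i => exists k, i = iter k f (io n.+1)).
  - move=> N; exists (iter N f (io n.+1)); last by exists N.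
    by elim: N => // N IHN /=; apply: leq_ltn_trans IHN _; exact: f_gt.
  - by move=> [k hk]; have := it0 k; rewrite -hk.
  exists z; split; first by apply/hz; exists (io n.+1); split=> //; exists 0%N.
  split; first by apply/hz; exists (iter a f (io n.+1)); split=> //; exists a.
  move=> _ _ /hz [_ [[[|k] ->] ->]]; first by left.
  right; exists (Er (iter k f (io n.+1))); split; last first.
    by apply/fRE; exists (iter k f (io n.+1)).
  by apply/hz; exists (iter k f (io n.+1)); split=> //; exists k.
have dW := dfn_Wt dfn_Ws.
have dle t1 t2 : dterm t1 -> dterm t2 -> dfn A B (fun v => le_step (t1 v) (t2 v)).
  apply: dfn_subst2; rewrite /le_step; dfn_tac.
  by apply: (dfn_amb dfn_Wr); dterm_tac.
have dfR t1 t2 : dterm t1 -> dterm t2 -> dfn A B (fun v => fR (t1 v) (t2 v)).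
  apply: dfn_subst2; rewrite /fR.
  by dfn_tac; try (apply: dW; dterm_tac); apply: dle; dterm_tac.
have dNI t1 : dterm t1 -> dfn A B (fun v => NI (t1 v)).
  apply: dfn_subst1; rewrite /NI.
  by dfn_tac; try (apply: dW; dterm_tac); apply: dfR; dterm_tac.
have diota t1 t2 : dterm t1 -> dterm t2 -> dfn A B (fun v => iota (t1 v) (t2 v)).
  apply: dfn_subst2; rewrite /iota.
  by dfn_tac; try (apply: dNI; dterm_tac); apply: dfR; dterm_tac.
apply: (@dfn_relation _ _ _ s s_ge2 dfn_Ws _ Rho
  (fun n c => exists a, c = (L * iter a f (io n.+1))%N)).
- rewrite /Rho; dfn_tac; try (apply: dW; dterm_tac); try (apply: dfR; dterm_tac).
  by apply: diota; dterm_tac.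
- by move=> u w /RhoE [n [a [-> _]]]; exists n; rewrite /Er mulnA.
- move=> c n; rewrite -mulnA RhoE; split.
    move=> [n' [a [/(Er_inj) /eqP]]]; rewrite eqn_pmul2l ?eqSS; last by lia.
    by move=> /eqP -> /(expVn_inj s_ge2) ->; exists a.
  by move=> [a ->]; exists n, a.
- move=> n n' c [a ->] [a' /eqP]; rewrite eqn_pmul2l // => /eqP e.
  have [h1 h2 h3 _] := ioP n.+1; have [h1' h2' h3' _] := ioP n'.+1.
  have eio := orbit_disjoint S2 SQ fE h1 h1' (io0 _) (io0 _) e.
  (* Equal seeds lie in both intervals $(f(S_0(n+1)), f(S_0(n+2)))$ and $(f(S_0(n'+1)),
     f(S_0(n'+2)))$, which forces $n = n'$. *)
  have m1 : (f (S0 * n.+1) < f (S0 * n'.+2))%N by lia.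
  have m2 : (f (S0 * n'.+1) < f (S0 * n.+2))%N by lia.
  have mon i j : (f i < f j)%N -> (i < j)%N.
    by case: (ltngtP i j) => // [/(stretch_mono S2 SQ fE)|->]; lia.
  by move/mon: m1; move/mon: m2; rewrite !ltn_mul2l; lia.
- move=> n N; exists (L * iter N f (io n.+1))%N; split; last by exists N.
  apply: (@leq_trans (iter N f (io n.+1))); last by rewrite leq_pmull.
  have it0 k : (0 < iter k f (io n.+1))%N by elim: k => [|k IHk] //=; exact: f0.
  by elim: N => // N IHN /=; apply: leq_ltn_trans IHN _; exact: f_gt.
Qed.

End SamePrimes.

(** * Consequences of irrationality and assembly of the two cases *)

Lemma irrational_not_adic (R : realType) (s : nat) (z : R) (m M : nat) :
  (0 < s)%N -> irrational z -> s%:R ^+ m * z <> M%:R.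
Proof.
move=> s0 irr h; apply: irr; exists (M%:R / s%:R ^+ m) => //.
rewrite fmorph_div rmorphXn /= !ratr_nat -h mulrAC mulfV ?mul1r //.
by rewrite expf_neq0 // pnatr_eq0; lia.
Qed.

Lemma irrational_log_neq (R : realType) (r s L G : nat) : (2 <= r)%N -> (2 <= s)%N ->
  (0 < L)%N -> irrational (log R r s) -> (s ^ L)%N <> (r ^ G)%N.
Proof.
move=> r2 s2 L0 irr e; apply: irr; exists (G%:R / L%:R) => //.
have r1 : 1 < r%:R :> R by rewrite ltr1n.
have s1 : 1 < s%:R :> R by rewrite ltr1n.
have : ln (s%:R ^+ L) = ln (r%:R ^+ G) :> R by rewrite -!natrX e.
rewrite !lnXn ?(lt_trans ltr01) // => h.
have lr : ln r%:R != 0 :> R by rewrite gt_eqF // ln_gt0.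
rewrite /log fmorph_div /= !ratr_nat.
apply/eqP; rewrite eqr_div ?pnatr_eq0 //; last by rewrite -lt0n.
by rewrite !mulr_natl [ln s%:R * _]mulr_natr h.
Qed.

Theorem theoremC (R : realType) (r s : nat) (hr : (2 <= r)%N) (hs : (2 <= s)%N)
    (hlog : irrational (log R r s)) :
  forall (n : nat) (X : set 'rV[R]_n), compact X -> definable (W r) (W s) X.
Proof.
move=> n X.
have dWr := dfn_W1 (W r) (W s : set (R * R * R)).
have dWs := dfn_W2 (W r : set (R * R * R)) (W s).
have [K K0 dfn_rel] : exists2 K, (0 < K)%N & forall T : nat -> nat -> Prop,
    dfn (W r) (W s) (fun v => exists n m, [/\ T n m, v 0%N = s%:R ^- (K * n.+1) :> R
      & v 1%N = s%:R ^- (K * m.+1)]).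
  (* Either every prime of $s$ divides $r$, with $K = L s^L$, or some prime does not, with $K =
     1$. *)
  have [/allP sr|] := boolP (all [in primes r] (primes s)).
    have [L [G [L0 Lev dvd min]]] := exponents_of_primes hr hs sr.
    exists (L * s ^ L)%N; first by rewrite muln_gt0 L0 expn_gt0; lia.
    have neq := irrational_log_neq hr hs L0 hlog.
    by move=> T; exact: (dfn_relation_same_primes hr hs L0 Lev dvd min (neq _)).
  case/allPn => p; rewrite !mem_primes => /and3P[p_pr _ ps].
  rewrite p_pr /= negb_and => /orP[|pr]; first by lia.
  by exists 1%N => // T; exact: (dfn_relation_new_prime hr hs p_pr ps pr).
have s0 : (0 < s)%N by lia.
(* The fractional part of $\log_r s$ serves as an irrational number in $(0,1)$. *)
pose zeta : R := log R r s - (Num.floor (log R r s))%:~R.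
have zeta_irr : irrational zeta.
  have -> : zeta = log R r s + ratr (- (Num.floor (log R r s))%:~R).
    by rewrite rmorphN /= ratr_int.
  exact: irrational_addq.
have zeta01 : 0 < zeta < 1.
  have /andP[h1 h2] := floor_itv (log R r s).
  rewrite lt_def subr_ge0 h1 andbT; apply/andP; split; last first.
    by rewrite ltrBlDl; move: h2; rewrite intrD.
  by apply/eqP => z0; apply: zeta_irr; exists 0 => //; rewrite rmorph0.
apply: (@definable_compact _ _ _ (fun k => s%:R ^- (K * k.+1)) _ _ _ zeta) => //.
- by move=> i j /(expVn_inj hs) /eqP; rewrite eqn_pmul2l // => /eqP [].
- exact: dfn_index.
- move=> z z01 zirr; apply: dfn_seq => // k m M; exact: irrational_not_adic.
Qed.
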